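(* Let $(\Omega,\Sigma,\lambda)$ be a probability space, $L_1=L_1(\Omega,\Sigma,\lambda)$, and let $X\subset L_1$ be a closed subspace. Then $X$ is a rich subspace of $L_1$ if and only if $\frac12 B(L_1)\subset C_Y$ for all $1$-codimensional subspaces $Y$ of $X$.
   Context: Scalars are real or complex. Subspaces are understood to be closed. For a Banach space $W$, $B(W)$ is its closed unit ball and $S(W)$ its unit sphere. A slice of $B(W)$ is a nonvoid set of the form $\{w\in B(W): \operatorname{Re} w^*(w)>\alpha\}$ with $w^*\in W^*$, $\alpha\in\mathbb{R}$. An operator $T\colon W\to V$ between Banach spaces is narrow if for every $x,y\in S(W)$, every $\varepsilon>0$ and every slice $S$ of $B(W)$ containing $y$ there is $v\in S$ with $\|x+v\|>2-\varepsilon$ and $\|T(y-v)\|<\varepsilon$. A subspace $Z$ of $W$ is rich in $W$ if the quotient map $q\colon W\to W/Z$ is narrow. For a closed subspace $Y\subset L_1$, $C_Y$ denotes the closure of the ball $B(Y)$ (unit ball for the $L_1$-norm) in $L_1$ with respect to the topology of convergence in measure (the $L_0$-topology).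
   Formalization: The formal theorem assumes X is not {0}: for X = {0} there are no 1-codimensional subspaces, so the ball condition holds vacuously, while {0} is not rich in L_1 (take x = -y), so the equivalence fails there. *)

(* Defs.v *)
From HB Require Import structures.
From mathcomp Require Import all_boot all_order all_algebra.
From mathcomp Require Import generic_quotient ring_quotient.
From mathcomp Require Import all_classical all_reals all_analysis.
From mathcomp Require Import measurable_realfun.
From mathcomp Require Import complex.

Set Implicit Arguments.
Unset Strict Implicit.
Unset Printing Implicit Defensive.

Import Order.TTheory GRing.Theory Num.Theory.
Import numFieldNormedType.Exports.

Local Open Scope classical_set_scope.
Local Open Scope ring_scope.

(* Real or complex scalars.  In a normed module over a numFieldType K the norm
   takes its values in K: for K = R[i] these are the nonnegative reals of R[i],
   and x < y in R[i] entails that y - x is a (positive) real. *)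
Variant scalars := Reals | Complexes.

Definition scalar_field (R : realType) (s : scalars) : numFieldType :=
  match s with Reals => R | Complexes => R[i] end.

Definition re (R : realType) (s : scalars) : scalar_field R s -> R :=
  match s with Reals => fun z => z | Complexes => fun z => complex.Re z end.

Definition im (R : realType) (s : scalars) : scalar_field R s -> R :=
  match s with Reals => fun=> 0 | Complexes => fun z => complex.Im z end.

Definition ofR (R : realType) (s : scalars) : R -> scalar_field R s :=
  match s with Reals => fun r => r | Complexes => fun r => Complex r 0 end.
Arguments ofR {R s}.

(* The norm as an element of R. *)
Definition rnorm (R : realType) (s : scalars)
    (W : normedZmodType (scalar_field R s)) (w : W) : R := re `|w|.

Section scalar_theory.
Context (R : realType) (s : scalars).
Local Notation K := (scalar_field R s).
Implicit Types (z w : K) (r : R).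

Lemma re_ofR r : re (ofR r : K) = r. Proof. by case: s. Qed.

Lemma im_ofR r : im (ofR r : K) = 0. Proof. by case: s. Qed.

Lemma reD z w : re (z + w) = re z + re w.
Proof. by case: s z w => //= -[? ?] [? ?]. Qed.

Lemma imD z w : im (z + w) = im z + im w.
Proof. by case: s z w => /= [z w|[? ?] [? ?]//]; rewrite addr0. Qed.

Lemma reM z w : re (z * w) = re z * re w - im z * im w.
Proof. by case: s z w => /= [z w|[? ?] [? ?]//]; rewrite mul0r subr0. Qed.

Lemma imM z w : im (z * w) = re z * im w + im z * re w.
Proof. by case: s z w => /= [z w|[? ?] [? ?]//]; rewrite mulr0 mul0r addr0. Qed.

Lemma re0 : re (0 : K) = 0. Proof. by case: s. Qed.

Lemma im0 : im (0 : K) = 0. Proof. by case: s. Qed.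

Lemma ofR0 : ofR 0 = 0 :> K. Proof. by case: s. Qed.

Lemma ofRD r r' : ofR (r + r') = ofR r + ofR r' :> K.
Proof. by case: s => //=; rewrite /GRing.add/= addr0. Qed.

Lemma ofRM r r' : ofR (r * r') = ofR r * ofR r' :> K.
Proof.
by case: s => //=; rewrite [RHS]/GRing.mul/= !mulr0 mul0r addr0 subr0.
Qed.

Lemma ler_ofR r r' : (ofR r <= ofR r' :> K) = (r <= r').
Proof. by case: s => //=; rewrite lecE/= eqxx. Qed.

Lemma ltr_ofR r r' : (ofR r < ofR r' :> K) = (r < r').
Proof. by case: s => //=; rewrite ltcE/= eqxx. Qed.

Lemma ofR_inj : injective (ofR : R -> K).
Proof. by move=> r r' /(congr1 (@re R s)); rewrite !re_ofR. Qed.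

Lemma rnormE (W : normedZmodType K) (w : W) : `|w| = ofR (rnorm w).
Proof.
rewrite /rnorm; move: (normr_ge0 w); move: `|w| => {w W}.
by case: s => //= -[a b]; rewrite lecE/= => /andP[/eqP ->].
Qed.

Lemma rnorm_ge0 (W : normedZmodType K) (w : W) : 0 <= rnorm w.
Proof. by rewrite -ler_ofR -rnormE ofR0. Qed.

Lemma rnormD (W : normedZmodType K) (v w : W) :
  rnorm (v + w) <= rnorm v + rnorm w.
Proof. by rewrite -ler_ofR ofRD -!rnormE ler_normD. Qed.

Lemma rnormZ (W : normedModType K) z (w : W) :
  rnorm (z *: w) = rnorm z * rnorm w.
Proof. by apply: ofR_inj; rewrite ofRM -!rnormE normrZ. Qed.

Lemma rnormM z w : rnorm (z * w) = rnorm z * rnorm w.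
Proof. by apply: ofR_inj; rewrite ofRM -!rnormE normrM. Qed.

Lemma rnorm_sqrt z : rnorm z = Num.sqrt (re z ^+ 2 + im z ^+ 2).
Proof.
rewrite /rnorm; case: s z => /= [z|[a b]]; last first.
  exact: (congr1 (@complex.Re R) (normc_def (Complex a b))).
by rewrite expr0n/= addr0 sqrtr_sqr.
Qed.

End scalar_theory.

Record linear_subspace (K : numFieldType) (V : lmodType K) := LinearSubspace {
  carrier :> set V ;
  carrier0 : carrier 0 ;
  carrierP : forall (a : K) u v, carrier u -> carrier v -> carrier (a *: u + v)
}.

Section linear_quotient.
Context (K : numFieldType) (V : lmodType K) (Z : linear_subspace V).

Definition lin_pred : {pred V} := mem (carrier Z).

Lemma lin_pred_submod_closed : submod_closed lin_pred.
Proof.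
split=> [|a u v]; first by apply/mem_set; exact: carrier0.
by move=> /set_mem Zu /set_mem Zv; apply/mem_set; exact: carrierP.
Qed.

HB.instance Definition _ :=
  GRing.isSubmodClosed.Build K V lin_pred lin_pred_submod_closed.

Definition lquot : Type := Quotient.quot lin_pred.

HB.instance Definition _ := GRing.Zmodule.on lquot.

Definition lproj (v : V) : lquot := (\pi_(Quotient.quot lin_pred) v)%qT.

Lemma lprojP (u v : V) : lproj u = lproj v <-> carrier Z (u - v).
Proof.
split=> [/eqP|Zuv]; last apply/eqP.
  by rewrite -Quotient.idealrBE => /set_mem.
by rewrite -Quotient.idealrBE; apply/mem_set.
Qed.

Lemma lproj_surj (q : lquot) : exists v, lproj v = q.
Proof. by exists (repr (q : Quotient.quot lin_pred)); exact: reprK. Qed.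

Lemma lproj_zmod_morphism : zmod_morphism lproj.
Proof. exact: pi_is_zmod_morphism. Qed.

HB.instance Definition _ :=
  GRing.isZmodMorphism.Build V lquot lproj lproj_zmod_morphism.

Definition lquot_scale (a : K) (q : lquot) : lquot :=
  lproj (a *: repr (q : Quotient.quot lin_pred)).

Lemma lproj_scale (a : K) (v : V) : lquot_scale a (lproj v) = lproj (a *: v).
Proof.
apply/lprojP; rewrite -scalerBr -[X in carrier Z X]addr0; apply: carrierP (carrier0 Z).
by apply/lprojP; exact: reprK.
Qed.

Lemma lquot_scaleA (a b : K) (q : lquot) :
  lquot_scale a (lquot_scale b q) = lquot_scale (a * b) q.
Proof. by have [v <-] := lproj_surj q; rewrite !lproj_scale scalerA. Qed.

Lemma lquot_scale1 : left_id 1 lquot_scale.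
Proof. by move=> q; have [v <-] := lproj_surj q; rewrite lproj_scale scale1r. Qed.

Lemma lquot_scaleDr : right_distributive lquot_scale +%R.
Proof.
move=> a p q; have [u <-] := lproj_surj p; have [v <-] := lproj_surj q.
by rewrite -raddfD !lproj_scale scalerDr raddfD.
Qed.

Lemma lquot_scaleDl (q : lquot) : {morph lquot_scale^~ q : a b / a + b}.
Proof.
by move=> a b; have [v <-] := lproj_surj q; rewrite !lproj_scale scalerDl raddfD.
Qed.

HB.instance Definition _ := GRing.Zmodule_isLmodule.Build K lquot
  lquot_scaleA lquot_scale1 lquot_scaleDr lquot_scaleDl.

Lemma lproj_scalable : scalable lproj.
Proof. by move=> a v; rewrite -lproj_scale. Qed.

HB.instance Definition _ :=
  GRing.isScalable.Build K V lquot *:%R lproj lproj_scalable.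

End linear_quotient.

Record closed_subspace (K : numFieldType) (W : normedModType K) := ClosedSubspace {
  sub_lin :> linear_subspace W ;
  sub_closed : closed sub_lin
}.

Section normed_quotient.
Context (R : realType) (s : scalars).
Local Notation K := (scalar_field R s).
Context (W : normedModType K) (Z : closed_subspace W).

Definition quotient_space : Type := lquot Z.

HB.instance Definition _ := GRing.Lmodule.on quotient_space.

Definition quotient_map : W -> quotient_space := @lproj K W Z.

HB.instance Definition _ := GRing.Linear.on quotient_map.

Definition quotient_rnorm (q : quotient_space) : R :=
  inf [set rnorm w | w in [set w | quotient_map w = q]].

Lemma quotient_rnorm_nonempty (q : quotient_space) :
  [set rnorm w | w in [set w | quotient_map w = q]] !=set0.
Proof. by have [w wq] := lproj_surj q; exists (rnorm w), w. Qed.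

Lemma quotient_rnorm_lbound (q : quotient_space) :
  lbound [set rnorm w | w in [set w | quotient_map w = q]] 0.
Proof. by move=> _ [w _ <-]; exact: rnorm_ge0. Qed.

Lemma quotient_rnorm_ge0 (q : quotient_space) : 0 <= quotient_rnorm q.
Proof.
by apply: lb_le_inf; [exact: quotient_rnorm_nonempty
                     |exact: quotient_rnorm_lbound].
Qed.

Lemma quotient_rnorm_le (w : W) : quotient_rnorm (quotient_map w) <= rnorm w.
Proof.
by apply: ge_inf; [exists 0; exact: quotient_rnorm_lbound | exists w].
Qed.

Lemma quotient_rnorm_adherent (q : quotient_space) (e : R) : 0 < e ->
  exists2 w : W, quotient_map w = q & rnorm w < quotient_rnorm q + e.
Proof.
move=> e0; have [_ [w wq <-] we] := inf_adherent e0
  (conj (quotient_rnorm_nonempty q) (ex_intro _ 0 (@quotient_rnorm_lbound q))).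
by exists w.
Qed.

Lemma quotient_rnormD (p q : quotient_space) :
  quotient_rnorm (p + q) <= quotient_rnorm p + quotient_rnorm q.
Proof.
apply/ler_addgt0Pr => e e0; have e20 : 0 < e / 2 by rewrite divr_gt0.
have [u <- uE] := quotient_rnorm_adherent p e20.
have [v <- vE] := quotient_rnorm_adherent q e20.
rewrite -raddfD (le_trans (quotient_rnorm_le _))// (le_trans (rnormD _ _))//.
by rewrite [e]splitr addrACA lerD// ltW.
Qed.

Lemma quotient_rnormZ_le (a : K) (q : quotient_space) :
  quotient_rnorm (a *: q) <= rnorm a * quotient_rnorm q.
Proof.
apply/ler_addgt0Pr => e e0.
have a1 : 0 < rnorm a + 1 by rewrite ltr_wpDl// rnorm_ge0.
have [w <- wE] := quotient_rnorm_adherent q (divr_gt0 e0 a1).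
rewrite -linearZ (le_trans (quotient_rnorm_le _))// rnormZ.
rewrite (le_trans (ler_wpM2l (rnorm_ge0 _) (ltW wE)))// mulrDr lerD2l.
by rewrite mulrCA ler_piMr ?(ltW e0)// ler_pdivrMr// mul1r lerDl.
Qed.

Lemma quotient_rnormZ (a : K) (q : quotient_space) :
  quotient_rnorm (a *: q) = rnorm a * quotient_rnorm q.
Proof.
apply/eqP; rewrite eq_le quotient_rnormZ_le/=.
have [->|a0] := eqVneq a 0.
  by rewrite {1}/rnorm normr0 re0 mul0r quotient_rnorm_ge0.
have na0 : 0 < rnorm a by rewrite -(@ltr_ofR R s) -rnormE ofR0 normr_gt0.
rewrite -ler_pdivlMl//.
have -> : (rnorm a)^-1 = rnorm a^-1.
  apply: (mulfI (lt0r_neq0 na0)); rewrite -rnormM !divff// ?lt0r_neq0//.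
  by apply: (@ofR_inj R s); rewrite -rnormE normr1; case: (s).
by rewrite -[X in quotient_rnorm X <= _](scalerK a0) quotient_rnormZ_le.
Qed.

Lemma quotient_rnorm0_eq0 (q : quotient_space) : quotient_rnorm q = 0 -> q = 0.
Proof.
have [w <-] := lproj_surj q => w0.
suff Zw : carrier Z w by rewrite -(raddf0 quotient_map); apply/lprojP; rewrite subr0.
apply: (@sub_closed K W Z) => B /nbhs_ballP[e /= e0 eB].
have eE : e = ofR (rnorm e) by rewrite -rnormE gtr0_norm.
have re0 : 0 < rnorm e by rewrite -(@ltr_ofR R s) ofR0 -eE.
have [v vw] := quotient_rnorm_adherent (quotient_map w) re0.
rewrite w0 add0r => ve; exists (w - v); split.
  by have /lprojP := esym vw.
apply: eB; rewrite -ball_normE /ball_/= opprB addrC subrK.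
by rewrite rnormE eE ltr_ofR.
Qed.

Lemma quotient_ler_normD (p q : quotient_space) :
  ofR (quotient_rnorm (p + q)) <=
  ofR (quotient_rnorm p) + ofR (quotient_rnorm q) :> K.
Proof. by rewrite -ofRD ler_ofR quotient_rnormD. Qed.

Lemma quotient_normrZ (a : K) (q : quotient_space) :
  ofR (quotient_rnorm (a *: q)) = `|a| * ofR (quotient_rnorm q) :> K.
Proof. by rewrite quotient_rnormZ ofRM -rnormE. Qed.

Lemma quotient_normr0_eq0 (q : quotient_space) :
  ofR (quotient_rnorm q) = 0 :> K -> q = 0.
Proof. by rewrite -ofR0 => /ofR_inj/quotient_rnorm0_eq0. Qed.

HB.instance Definition _ := Lmodule_isNormed.Build K quotient_space
  quotient_ler_normD quotient_normrZ quotient_normr0_eq0.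

Lemma quotient_map_norm_le (w : W) : `|quotient_map w| <= `|w|.
Proof. by rewrite [leRHS]rnormE ler_ofR quotient_rnorm_le. Qed.

Lemma quotient_map_continuous : continuous quotient_map.
Proof.
apply: bounded_linear_continuous; apply/linear_boundedP.
near=> r => w; rewrite (le_trans (quotient_map_norm_le w))//.
by rewrite ler_peMl//; near: r; apply: nbhs_pinfty_ge; rewrite real1.
Unshelve. all: by end_near. Qed.

End normed_quotient.

Section narrow_operators.
Context (R : realType) (s : scalars).
Local Notation K := (scalar_field R s).

Definition unit_ball (W : normedModType K) : set W := [set w | `|w| <= 1].

Definition unit_sphere (W : normedModType K) : set W := [set w | `|w| = 1].

(* K^o is K seen as a normed module over itself: f ranges over the dual of W. *)
Definition slice (W : normedModType K) (S : set W) : Prop :=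
  S !=set0 /\
  exists (f : {linear W -> K^o}) (alpha : R),
    continuous f /\ S = [set w | `|w| <= 1 /\ alpha < re (f w : K)].

Definition narrow (W V : normedModType K) (T : {linear W -> V}) : Prop :=
  continuous T /\
  forall (x y : W) (e : K) (S : set W),
    unit_sphere x -> unit_sphere y -> 0 < e -> slice S -> S y ->
    exists v : W, [/\ S v, 2 - e < `|x + v| & `|T (y - v)| < e].

Definition rich (W : normedModType K) (Z : closed_subspace W) : Prop :=
  narrow (quotient_map Z).

End narrow_operators.
Arguments unit_ball {R s} W.
Arguments unit_sphere {R s} W.

Definition one_codimensional (K : numFieldType) (W : normedModType K)
    (X Y : closed_subspace W) : Prop :=
  Y `<=` X /\
  exists2 x0 : W, carrier X x0 /\ ~ carrier Y x0 &
    forall x, carrier X x -> exists a : K, carrier Y (x - a *: x0).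

Section L1_space.
Context (R : realType) (s : scalars) (d : measure_display).
Context (T : measurableType d) (P : probability T R).
Local Notation K := (scalar_field R s).

(* Integrability of both the real and the imaginary part, i.e. f is measurable
   and |f| has finite integral (see measurable_rnorm, integrable_rnorm). *)
Definition sintegrable (f : T -> K^o) : Prop :=
  P.-integrable setT (EFin \o (fun t => re (f t : K))) /\
  P.-integrable setT (EFin \o (fun t => im (f t : K))).

Definition sintegrable_pred : {pred T -> K^o} := mem [set f | sintegrable f].

Lemma sintegrable_submod_closed : submod_closed sintegrable_pred.
Proof.
split=> [|a f g /set_mem[rf jf] /set_mem[rg jg]]; apply/mem_set; split.
- rewrite (_ : _ \o _ = cst 0%E); first exact: integrable0.
  by apply/funext => t /=; rewrite re0.
- rewrite (_ : _ \o _ = cst 0%E); first exact: integrable0.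
  by apply/funext => t /=; rewrite im0.
- rewrite (_ : _ \o _ = ((fun t => (re (a : K))%:E * (re (f t : K))%:E) \-
      (fun t => (im (a : K))%:E * (im (f t : K))%:E)) \+
      (fun t => (re (g t : K))%:E))%E; last first.
    by apply/funext => t /=; rewrite reD reM.
  by apply: integrableD => //; apply: integrableB => //; exact: integrableZl.
- rewrite (_ : _ \o _ = ((fun t => (re (a : K))%:E * (im (f t : K))%:E) \+
      (fun t => (im (a : K))%:E * (re (f t : K))%:E)) \+
      (fun t => (im (g t : K))%:E))%E; last first.
    by apply/funext => t /=; rewrite imD imM.
  by apply: integrableD => //; apply: integrableD => //; exact: integrableZl.
Qed.

HB.instance Definition _ := GRing.isSubmodClosed.Build K (T -> K^o)
  sintegrable_pred sintegrable_submod_closed.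

Record integrable_fun := IntegrableFun {
  integrable_val :> T -> K^o ;
  integrable_valP : integrable_val \in sintegrable_pred
}.

HB.instance Definition _ := [isSub for integrable_val].
HB.instance Definition _ := [Choice of integrable_fun by <:].
HB.instance Definition _ :=
  [SubChoice_isSubLmodule of integrable_fun by <:].

Lemma integrable_funP (f : integrable_fun) : sintegrable f.
Proof. by have /set_mem := integrable_valP f. Qed.

Lemma measurable_rnorm (f : integrable_fun) :
  measurable_fun setT (fun t => rnorm (f t : K)).
Proof.
have [/measurable_int/measurable_EFinP mr /measurable_int/measurable_EFinP mi]
  := integrable_funP f.
rewrite (_ : (fun t => _) =
    Num.sqrt \o (fun t => re (f t : K) ^+ 2 + im (f t : K) ^+ 2)); last first.
  by apply/funext => t; rewrite rnorm_sqrt.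
apply: measurableT_comp.
  by apply: continuous_measurable_fun; exact: sqrt_continuous.
by apply: measurable_funD; apply: measurable_funX.
Qed.

Lemma integrable_rnorm (f : integrable_fun) :
  P.-integrable setT (EFin \o (fun t => rnorm (f t : K))).
Proof.
have [ir ii] := integrable_funP f.
have := integrableD measurableT (integrable_abse ir) (integrable_abse ii).
apply: le_integrable => //; first exact/measurable_EFinP/measurable_rnorm.
move=> t _ /=; rewrite lee_fin ger0_norm ?rnorm_ge0// ger0_norm ?addr_ge0//.
rewrite rnorm_sqrt -(ler_pXn2r (ltn0Sn 1)) ?nnegrE ?sqrtr_ge0 ?addr_ge0//.
rewrite sqr_sqrtr ?addr_ge0 ?sqr_ge0// sqrrD !real_normK ?num_real//.
by rewrite lerD2r lerDl mulrn_wge0// mulr_ge0.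
Qed.

Lemma null0 : {ae P, forall t, (0 : integrable_fun) t = 0}.
Proof. exact: nearW. Qed.

Lemma nullP (a : K) (f g : integrable_fun) :
  {ae P, forall t, f t = 0} -> {ae P, forall t, g t = 0} ->
  {ae P, forall t, (a *: f + g) t = 0}.
Proof.
apply: filterS2 => t ft gt.
by rewrite -[LHS]/(a *: f t + g t) ft gt scaler0 addr0.
Qed.

Definition null_subspace : linear_subspace integrable_fun :=
  @LinearSubspace K integrable_fun
    [set f : integrable_fun | {ae P, forall t, f t = 0}] null0 nullP.

Definition L1 : Type := lquot null_subspace.

HB.instance Definition _ := GRing.Lmodule.on L1.

Definition L1_class : integrable_fun -> L1 := @lproj K _ null_subspace.

HB.instance Definition _ := GRing.Linear.on L1_class.

Definition L1_val (f : L1) : integrable_fun :=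
  repr (f : Quotient.quot (lin_pred null_subspace)).

Lemma L1_valK : cancel L1_val L1_class.
Proof. by move=> f; exact: reprK. Qed.

Lemma L1_classP (f g : integrable_fun) :
  L1_class f = L1_class g <-> {ae P, forall t, f t = g t}.
Proof.
split=> [/lprojP fg|fg].
  have {}fg : {ae P, forall t, (f - g) t = 0} by [].
  by apply: filterS fg => t /eqP; rewrite subr_eq0 => /eqP.
apply/lprojP; have : {ae P, forall t, (f - g) t = 0}.
  by apply: filterS fg => t fgt; apply/eqP; rewrite subr_eq0; exact/eqP.
by [].
Qed.

Lemma L1_classK (f : integrable_fun) :
  {ae P, forall t, L1_val (L1_class f) t = f t}.
Proof. by apply/L1_classP; rewrite L1_valK. Qed.

Definition L1_rnorm (f : L1) : R := \int[P]_t rnorm (L1_val f t : K).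

Lemma ae_Rintegral_rnorm (f g : integrable_fun) :
  {ae P, forall t, f t = g t} ->
  \int[P]_t rnorm (f t : K) = \int[P]_t rnorm (g t : K).
Proof.
move=> fg; congr fine; apply: ae_eq_integral => //.
- exact/measurable_EFinP/measurable_rnorm.
- exact/measurable_EFinP/measurable_rnorm.
- by apply: filterS fg => t /= -> _.
Qed.

Lemma L1_rnormE (f : integrable_fun) :
  L1_rnorm (L1_class f) = \int[P]_t rnorm (f t : K).
Proof. exact/ae_Rintegral_rnorm/L1_classK. Qed.

Lemma L1_rnormD (f g : L1) : L1_rnorm (f + g) <= L1_rnorm f + L1_rnorm g.
Proof.
rewrite -[f]L1_valK -[g]L1_valK -raddfD !L1_rnormE.
move: (L1_val f) (L1_val g) => {}f {}g.
rewrite -RintegralD ?integrable_rnorm//; apply: le_Rintegral => //.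
- exact: integrable_rnorm.
- have := integrableD measurableT (integrable_rnorm f) (integrable_rnorm g).
  exact: eq_integrable.
- by move=> t _; exact: rnormD.
Qed.

Lemma L1_rnormZ (a : K) (f : L1) : L1_rnorm (a *: f) = rnorm a * L1_rnorm f.
Proof.
rewrite -[f]L1_valK -linearZ !L1_rnormE.
rewrite -RintegralZl ?integrable_rnorm//.
by apply: eq_Rintegral => t _; rewrite -rnormM.
Qed.

Lemma L1_rnorm0_eq0 (f : L1) : L1_rnorm f = 0 -> f = 0.
Proof.
rewrite -[f]L1_valK -(raddf0 L1_class) L1_rnormE.
move: (L1_val f) => {}f f0; apply/L1_classP.
have intf := integrable_rnorm f.
have : (\int[P]_(t in setT) `|(rnorm (f t : K))%:E| = 0)%E.
  under eq_integral do rewrite gee0_abs ?lee_fin ?rnorm_ge0//.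
  by rewrite -(fineK (integrable_fin_num measurableT intf)); congr EFin.
move/(ae_eq_integral_abs _ measurableT (measurable_int _ intf)).
apply: filterS => t /(_ I) [ft0]; apply/(@normr0_eq0 _ K).
by rewrite rnormE ft0 ofR0.
Qed.

Lemma L1_ler_normD (f g : L1) :
  ofR (L1_rnorm (f + g)) <= ofR (L1_rnorm f) + ofR (L1_rnorm g) :> K.
Proof. by rewrite -ofRD ler_ofR L1_rnormD. Qed.

Lemma L1_normrZ (a : K) (f : L1) :
  ofR (L1_rnorm (a *: f)) = `|a| * ofR (L1_rnorm f) :> K.
Proof. by rewrite L1_rnormZ ofRM -rnormE. Qed.

Lemma L1_normr0_eq0 (f : L1) : ofR (L1_rnorm f) = 0 :> K -> f = 0.
Proof. by rewrite -ofR0 => /ofR_inj/L1_rnorm0_eq0. Qed.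

HB.instance Definition _ := Lmodule_isNormed.Build K L1
  L1_ler_normD L1_normrZ L1_normr0_eq0.

(* L1 with the topology of convergence in measure; the pseudometric ball of
   radius e around f is [g | P(|f - g| >= e) < e] (Ky Fan). *)
Definition L1_in_measure : Type := L1.

HB.instance Definition _ := Choice.on L1_in_measure.

Definition measure_ball (f : L1_in_measure) (e : R) : set L1_in_measure :=
  [set g | (P [set t | (e <= rnorm (L1_val f t - L1_val g t : K))%R] < e%:E)%E].

Definition measure_ent : set_system (L1_in_measure * L1_in_measure) :=
  entourage_ measure_ball.

HB.instance Definition _ := hasNbhs.Build L1_in_measure (nbhs_ measure_ent).

Lemma measurable_rnorm_ge (f g : integrable_fun) (e : R) :
  measurable [set t | (e <= rnorm (f t - g t : K))%R].
Proof.
have := measurable_rnorm (f - g) measurableT (@measurable_itv R `[e, +oo[).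
rewrite setTI (_ : _ @^-1` _ = [set t | (e <= rnorm (f t - g t : K))%R])//.
by apply/seteqP; split=> t /=; rewrite in_itv/= andbT.
Qed.

Lemma measure_ball_center (f : L1_in_measure) (e : R) :
  0 < e -> measure_ball f e f.
Proof.
move=> e0; rewrite /measure_ball/=.
rewrite (_ : [set t | _] = set0) ?measure0 ?lte_fin//.
apply/seteqP; split=> t //=.
by rewrite subrr /rnorm normr0 re0 leNgt e0.
Qed.

Lemma measure_ball_sym (f g : L1_in_measure) (e : R) :
  measure_ball f e g -> measure_ball g e f.
Proof.
rewrite /measure_ball/= (_ : [set t | _] =
  [set t | (e <= rnorm (L1_val g t - L1_val f t : K))%R])//.
by apply/seteqP; split=> t /=; rewrite /rnorm distrC.
Qed.

Lemma measure_ball_triangle (f g h : L1_in_measure) (e1 e2 : R) :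
  measure_ball f e1 g -> measure_ball g e2 h -> measure_ball f (e1 + e2) h.
Proof.
rewrite /measure_ball/= => fg gh; rewrite EFinD.
apply: le_lt_trans (lteD fg gh).
apply: (@le_trans _ _ (P ([set t | (e1 <= rnorm (L1_val f t - L1_val g t : K))%R]
  `|` [set t | (e2 <= rnorm (L1_val g t - L1_val h t : K))%R]))).
  apply: le_measure; rewrite ?inE; [exact: measurable_rnorm_ge| |].
    by apply: measurableU; exact: measurable_rnorm_ge.
  move=> t /= le12; apply/orP; rewrite -implyNb -ltNge; apply/implyP => lt1.
  rewrite leNgt; apply/negP => lt2; move: le12; rewrite leNgt => /negP; apply.
  rewrite -(subrK (L1_val g t) (L1_val f t)) -addrA.
  by rewrite (le_lt_trans (rnormD _ _))// ltrD.
by apply: measureU2; exact: measurable_rnorm_ge.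
Qed.

HB.instance Definition _ := @Nbhs_isPseudoMetric.Build R L1_in_measure
  measure_ent erefl measure_ball measure_ball_center measure_ball_sym
  measure_ball_triangle erefl.

(* The set written C_Y. *)
Definition measure_closure (Y : closed_subspace L1) : set L1 :=
  closure (carrier Y `&` unit_ball L1 : set L1_in_measure).

Lemma measure_closureP (Y : closed_subspace L1) (f : L1) :
  measure_closure Y f <->
  forall e : R, 0 < e -> exists g : L1, [/\ carrier Y g, `|g| <= 1 &
    (P [set t | (e <= rnorm (L1_val f t - L1_val g t : K))%R] < e%:E)%E].
Proof.
split=> [Yf e e0|Yf B /nbhs_ballP[e /= e0 eB]].
  have [g [[Yg g1] fg]] := Yf _ (nbhsx_ballx (f : L1_in_measure) e e0).
  by exists g.
have [g [Yg g1 fg]] := Yf e e0.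
by exists g; split; [split|exact: eB].
Qed.

End L1_space.

Arguments L1 {R} s {d T} P.

(* Main.v *)
Require Import Defs.
From HB Require Import structures.
From mathcomp Require Import all_boot all_order all_algebra.
From mathcomp Require Import all_classical all_reals all_analysis.
From mathcomp Require Import measurable_realfun complex ring lra.
Import Order.TTheory GRing.Theory Num.Theory.
Import numFieldNormedType.Exports.
Local Open Scope classical_set_scope.
Local Open Scope ring_scope.

(** If [X] is rich and [Y] is the kernel in [X] of a functional [f],
the slice condition, applied repeatedly with each new slice directed against
the deviation accumulated so far, gives averages [v] with [y - v] almost in [X]
and almost killed by finitely many functionals; controlling [f] puts [y - v]
almost in [Y], and controlling a norming functional of [x1 + v1] allows
[x1 + v] and [x2 + v] to have norms close to 2 simultaneously.  For [x1 = 1] and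
[x2 = -1] this makes [v] small in measure, so that [(y - v) / 2] approximates
[y / 2] in measure.

Conversely, given a slice defined by [f], let [Y] be the kernel of [f] in [X].
Approximating [y / 2] in measure from the ball of [Y] gives [g] in [Y] such that
[y - g] has norm almost at most 1 and is concentrated on a set of small measure.
Adding an equally concentrated element of [Y] brings the norm to 1 without
changing the value of [f], and concentration makes the norm of the sum with [x]
almost 2. *)

(** * Scalars, the embedded reals, and the real-valued norm *)

Section rnorm_theory.
Context {R : realType} {s : scalars}.
Local Notation K := (scalar_field R s).

Lemma ofR1 : ofR 1 = 1 :> K. Proof. by case: s. Qed.

Lemma ofRN r : ofR (- r) = - ofR r :> K.
Proof. by apply/eqP; rewrite -addr_eq0 -ofRD addNr ofR0. Qed.

Lemma ofRB r t : ofR (r - t) = ofR r - ofR t :> K.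
Proof. by rewrite ofRD ofRN. Qed.

Lemma ofRV r : ofR r^-1 = (ofR r)^-1 :> K.
Proof.
have [->|r0] := eqVneq r 0; first by rewrite invr0 ofR0 invr0.
have o0 : ofR r != 0 :> K.
  by apply/eqP; rewrite -ofR0 => /ofR_inj/eqP; rewrite (negbTE r0).
by apply: (mulfI o0); rewrite -ofRM !divff// ofR1.
Qed.

Lemma ofR_nat n : ofR n%:R = n%:R :> K.
Proof. by elim: n => [|n IH]; rewrite ?ofR0// -!natr1 ofRD IH ofR1. Qed.

Lemma rnorm_ofR r : rnorm (ofR r : K) = `|r|.
Proof. by rewrite rnorm_sqrt re_ofR im_ofR expr0n/= addr0 sqrtr_sqr. Qed.

Lemma ler_re_rnorm (z : K) : `|re z| <= rnorm z.
Proof. by rewrite rnorm_sqrt -sqrtr_sqr ler_wsqrtr// lerDl sqr_ge0. Qed.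

Lemma reN (z : K) : re (- z) = - re z.
Proof. by apply/eqP; rewrite -addr_eq0 -reD addNr re0. Qed.

Lemma imN (z : K) : im (- z) = - im z.
Proof. by apply/eqP; rewrite -addr_eq0 -imD addNr im0. Qed.

Lemma reB (z w : K) : re (z - w) = re z - re w.
Proof. by rewrite reD reN. Qed.

Lemma reMofR r (z : K) : re (ofR r * z) = r * re z.
Proof. by rewrite reM re_ofR im_ofR mul0r subr0. Qed.

Section Zmod.
Context {W : normedZmodType K}.
Implicit Types u v w : W.

Lemma rnorm0 : rnorm (0 : W) = 0. Proof. by rewrite /rnorm normr0 re0. Qed.

Lemma rnormN w : rnorm (- w) = rnorm w. Proof. by rewrite /rnorm normrN. Qed.

Lemma rnorm_distC u v : rnorm (u - v) = rnorm (v - u).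
Proof. by rewrite /rnorm distrC. Qed.

Lemma rnorm_eq0 w : (rnorm w == 0) = (w == 0).
Proof.
apply/eqP/eqP => [w0|->]; last exact: rnorm0.
by apply/eqP; rewrite -normr_eq0 rnormE w0 ofR0.
Qed.

Lemma rnorm_gt0 w : (0 < rnorm w) = (w != 0).
Proof. by rewrite lt_neqAle rnorm_ge0 andbT eq_sym rnorm_eq0. Qed.

Lemma rnormB u v : rnorm (u - v) <= rnorm u + rnorm v.
Proof. by rewrite -(rnormN v) rnormD. Qed.

Lemma rnormBr u v : rnorm u - rnorm v <= rnorm (u - v).
Proof. by rewrite lerBlDr -{1}(subrK v u) rnormD. Qed.

Lemma rnormDr u v : rnorm u - rnorm v <= rnorm (u + v).
Proof. by rewrite -(rnormN v) -{2}(opprK v) rnormBr. Qed.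

Lemma norm_leE w r : (`|w| <= ofR r) = (rnorm w <= r).
Proof. by rewrite rnormE ler_ofR. Qed.

Lemma norm_ltE w r : (`|w| < ofR r) = (rnorm w < r).
Proof. by rewrite rnormE ltr_ofR. Qed.

Lemma norm_gtE w r : (ofR r < `|w|) = (r < rnorm w).
Proof. by rewrite rnormE ltr_ofR. Qed.

Lemma norm_le1 w : (`|w| <= 1) = (rnorm w <= 1).
Proof. by rewrite -ofR1 norm_leE. Qed.

Lemma norm_eq1 w : `|w| = 1 <-> rnorm w = 1.
Proof.
by split=> [|w1]; rewrite rnormE -?ofR1; [exact: ofR_inj|rewrite w1].
Qed.

End Zmod.

Lemma rnormZr (W : normedModType K) r (w : W) :
  rnorm (ofR r *: w) = `|r| * rnorm w.
Proof. by rewrite rnormZ rnorm_ofR. Qed.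

Lemma scaleofRA (W : lmodType K) (a b : R) (w : W) :
  ofR a *: (ofR b *: w) = ofR (a * b) *: w.
Proof. by rewrite scalerA ofRM. Qed.

Lemma gt0_ofR (e : K) : 0 < e -> e = ofR (rnorm e) /\ 0 < rnorm e.
Proof.
move=> e0; have eE : e = ofR (rnorm e) by rewrite -rnormE gtr0_norm.
by split => //; rewrite rnorm_gt0 gt_eqF.
Qed.

(** Serves the intermediate value theorem: a vector of the ball is moved along [w] until its norm is
    exactly 1. *)
Lemma rnorm_line_continuous (W : normedModType K) (u w : W) :
  continuous (fun t : R => rnorm (u + ofR t *: w)).
Proof.
move=> t; apply/cvgrPdist_lt => e e0.
have n0 : 0 < rnorm w + 1 by have := rnorm_ge0 w; lra.
have en : 0 < e / (rnorm w + 1) by rewrite divr_gt0.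
near=> r.
have tr : `|t - r| < e / (rnorm w + 1).
  by near: r; apply: (@cvgr_dist_lt _ _ _ (nbhs t) _ id t cvg_id).
have le_tr : `|t - r| * rnorm w < e.
  apply: (@le_lt_trans _ _ (`|t - r| * (rnorm w + 1))).
    by rewrite ler_wpM2l// lerDl.
  by rewrite -ltr_pdivlMr.
rewrite (le_lt_trans _ le_tr)// ler_norml; apply/andP.
have E a b : u + ofR a *: w = (u + ofR b *: w) + ofR (a - b) *: w.
  by rewrite ofRB scalerBl -addrA [ofR b *: w + _]addrC subrK.
have := rnormD (u + ofR r *: w) (ofR (t - r) *: w); rewrite -E rnormZr.
have := rnormD (u + ofR t *: w) (ofR (r - t) *: w); rewrite -E rnormZr distrC.
by split; lra.
Unshelve. all: by end_near. Qed.

End rnorm_theory.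

(** * The Hahn-Banach theorem through minimal sublinear functionals *)

Section Hahn_Banach.
Context {R : realType} {s : scalars}.
Local Notation K := (scalar_field R s).
Context {W : normedModType K}.
Implicit Types (p : W -> R) (u v w : W).

(** Homogeneity is an inequality at positive [r] only, a form that passes to infima; using it at
    [r^-1] too gives equality. *)
Definition sublinear p :=
  (forall u v, p (u + v) <= p u + p v) /\
  (forall r v, 0 < r -> p (ofR r *: v) <= r * p v).

Lemma sublinear_rnorm : sublinear (@rnorm R s W).
Proof.
by split=> [u v|r v r0]; [exact: rnormD|rewrite rnormZr gtr0_norm].
Qed.

Lemma sublinear0 p : sublinear p -> p 0 = 0.
Proof.
move=> [pD pZ]; apply/eqP; rewrite eq_le; apply/andP; split.
  by have := pZ 2^-1 0 ltac:(lra); rewrite scaler0; lra.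
by have := pD 0 0; rewrite addr0; lra.
Qed.

Lemma sublinearZ p r v : sublinear p -> 0 <= r -> p (ofR r *: v) = r * p v.
Proof.
move=> ps; rewrite le_eqVlt => /predU1P[<-|r0].
  by rewrite ofR0 scale0r mul0r sublinear0.
have [_ pZ] := ps; apply/eqP; rewrite eq_le pZ//= -ler_pdivlMl//.
have := pZ r^-1 (ofR r *: v); rewrite invr_gt0 => /(_ r0).
by rewrite scaleofRA mulVf ?gt_eqF// ofR1 scale1r.
Qed.

Lemma sublinear_lower p v : sublinear p -> - p (- v) <= p v.
Proof.
move=> ps; have [pD _] := ps.
by have := pD v (- v); rewrite subrr (sublinear0 _ ps); lra.
Qed.

(* A minimal sublinear functional p equals tilt p a for every a, which makes it
   odd, hence additive. *)
Definition tilt p (a v : W) : R :=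
  inf [set p (v + ofR t *: a) - t * p a | t in [set t | 0 <= t]].

Section tilt.
Context p (a : W) (ps : sublinear p).

Let vals v := [set p (v + ofR t *: a) - t * p a | t in [set t | 0 <= t]].

Let vals_lb v : has_lbound (vals v).
Proof.
exists (- p (- v)) => _ [t t0 <-]; have [pD _] := ps.
have := pD (v + ofR t *: a) (- v).
by rewrite addrAC subrr add0r sublinearZ//; lra.
Qed.

Let vals_inf v : has_inf (vals v).
Proof.
split; last exact: vals_lb.
by exists (p (v + ofR 0 *: a) - 0 * p a), 0 => //=.
Qed.

Lemma tilt_le v t : 0 <= t -> tilt p a v <= p (v + ofR t *: a) - t * p a.
Proof. by move=> t0; apply: ge_inf; [exact: vals_lb|exists t]. Qed.

Lemma tilt_adherent v e : 0 < e ->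
  exists2 t, 0 <= t & p (v + ofR t *: a) - t * p a < tilt p a v + e.
Proof.
by move=> e0; have [_ [t t0 <-] ?] := inf_adherent e0 (vals_inf v); exists t.
Qed.

Lemma tilt_le_self v : tilt p a v <= p v.
Proof.
by have := tilt_le v 0 (lexx 0); rewrite ofR0 scale0r addr0 mul0r subr0.
Qed.

Lemma tiltN : tilt p a (- a) <= - p a.
Proof.
have := tilt_le (- a) 1 ler01.
by rewrite ofR1 scale1r addNr (sublinear0 _ ps) mul1r sub0r.
Qed.

Lemma tilt_sublinear : sublinear (tilt p a).
Proof.
have [pD pZ] := ps; split=> [u v|r v r0].
  apply/ler_addgt0Pr => e e0; have e20 : 0 < e / 2 by rewrite divr_gt0.
  have [t t0 tE] := tilt_adherent u _ e20.
  have [t' t'0 t'E] := tilt_adherent v _ e20.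
  have := tilt_le (u + v) (t + t') (addr_ge0 t0 t'0).
  have := pD (u + ofR t *: a) (v + ofR t' *: a).
  by rewrite addrACA -scalerDl -ofRD; lra.
rewrite -ler_pdivrMl//; apply: lb_le_inf; first by case: (vals_inf v).
move=> _ [t t0 <-]; rewrite ler_pdivrMl//.
have := tilt_le (ofR r *: v) (r * t) (mulr_ge0 (ltW r0) t0).
have := pZ r (v + ofR t *: a) r0.
by rewrite scalerDr scaleofRA; lra.
Qed.

End tilt.

(** Zorn's lemma for the reversed pointwise order. The infimum over a chain is finite because each
    member satisfies [- p0 (- v) <= q v], and it is subadditive because any two members can be
    replaced by the smaller one. *)
Lemma minimal_sublinear (p0 : W -> R) : sublinear p0 ->
  exists p, [/\ sublinear p, forall v, p v <= p0 v &
    forall q, sublinear q -> (forall v, q v <= p v) -> q = p].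
Proof.
move=> ps0.
pose below := {p | sublinear p /\ forall v, p v <= p0 v}.
pose rel (p q : below) := `[< forall v, sval q v <= sval p v >].
have [||||[p [ps pp0]] pmin] := @Zorn below rel.
- by move=> p; apply/asboolP.
- move=> p q r /asboolP pq /asboolP qr; apply/asboolP => v.
  by rewrite (le_trans (qr v)).
- move=> [p pP] [q qP] /asboolP/= pq /asboolP/= qp; apply: eq_exist.
  by apply/funext => v; apply/eqP; rewrite eq_le pq qp.
- move=> A Atot.
  have [A0|/set0P[q0 Aq0]] := eqVneq A set0.
    by exists (exist _ p0 (conj ps0 (fun v => lexx _))) => q; rewrite A0.
  pose vals v := [set sval q v | q in A].
  have vlb v : has_lbound (vals v).
    exists (- p0 (- v)) => _ [[q [qs qp0]] Aq <-] /=.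
    by rewrite (le_trans _ (sublinear_lower q v qs))// lerN2.
  have vinf v : has_inf (vals v) by split => //; exists (sval q0 v), q0.
  have le_val q v : A q -> inf (vals v) <= sval q v.
    by move=> Aq; apply: ge_inf => //; exists q.
  suff qP : sublinear (fun v => inf (vals v)) /\ forall v, inf (vals v) <= p0 v.
    exists (exist _ (fun v => inf (vals v)) qP) => q Aq.
    by apply/asboolP => v; exact: le_val.
  split; last first.
    by move=> v; rewrite (le_trans (le_val _ v Aq0))//; case: (svalP q0).
  split=> [u v|r v r0].
    apply/ler_addgt0Pr => e e0; have e20 : 0 < e / 2 by rewrite divr_gt0.
    have [_ [q1 Aq1 <-] uE] := inf_adherent e20 (vinf u).
    have [_ [q2 Aq2 <-] vE] := inf_adherent e20 (vinf v).
    have [q [Aq qq1 qq2]] : exists q, [/\ A q, forall w, sval q w <= sval q1 w &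
        forall w, sval q w <= sval q2 w].
      have [/asboolP q12|/asboolP q21] := Atot q1 q2 Aq1 Aq2.
        by exists q2.
      by exists q1.
    have [[qD _] _] := svalP q.
    have := le_val q (u + v) Aq; have := qD u v.
    by have := qq1 u; have := qq2 v; lra.
  rewrite -ler_pdivrMl//; apply: lb_le_inf; first by case: (vinf v).
  move=> _ [q Aq <-]; rewrite ler_pdivrMl//.
  have [[_ qZ] _] := svalP q.
  exact: le_trans (le_val _ _ Aq) (qZ _ _ r0).
exists p; split=> // q qs qp.
have qP : sublinear q /\ forall v, q v <= p0 v.
  by split=> // v; exact: le_trans (qp v) (pp0 v).
by have := pmin (exist _ q qP) (introT (asboolP _) qp); case.
Qed.

(** By minimality [p] equals its tilt along [a], whose value at [- a] is at most [- p a]; the other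
    inequality is subadditivity. *)
Lemma minimal_sublinearN p a : sublinear p ->
  (forall q, sublinear q -> (forall v, q v <= p v) -> q = p) -> p (- a) = - p a.
Proof.
move=> ps pmin; apply/eqP; rewrite eq_le; apply/andP; split.
  rewrite -{1}(pmin _ (tilt_sublinear p a ps) (tilt_le_self p a ps)).
  exact: tiltN.
by have := sublinear_lower p a ps; lra.
Qed.

(** The minimal functional is taken below the norm tilted along [w0], not just below the norm: this
    forces [p (- w0) <= - rnorm w0], so that [p] is norming at [w0]. *)
Lemma real_norming w0 : exists p : W -> R,
  [/\ forall u v, p (u + v) = p u + p v, forall r v, p (ofR r *: v) = r * p v,
      forall v, p v <= rnorm v & p w0 = rnorm w0].
Proof.
have Ns := sublinear_rnorm.
have [p [ps pt pmin]] := minimal_sublinear _ (tilt_sublinear _ w0 Ns).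
have pN a := minimal_sublinearN p a ps pmin.
have pN_le v : p v <= rnorm v := le_trans (pt v) (tilt_le_self _ w0 Ns v).
exists p; split=> //.
- move=> u v; have [pD _] := ps; apply/eqP; rewrite eq_le pD/=.
  by have := pD (- u) (- v); rewrite -opprD !pN; lra.
- move=> r v; have [r0|/ltW r0] := leP 0 r; first exact: sublinearZ.
  rewrite -[r]opprK ofRN scaleNr pN sublinearZ ?oppr_ge0//.
  by rewrite opprK mulNr opprK.
- apply/eqP; rewrite eq_le pN_le/=.
  have := pt (- w0); have := tiltN _ w0 Ns; rewrite pN; lra.
Qed.

(** Unbundled elements of the dual, so that combinations and indexed families are plain functions;
    [functional_linear] bundles them again. *)
Definition functional (f : W -> K) : Prop :=
  (forall (a : K) u v, f (a *: u + v) = a * f u + f v) /\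
  (exists C, forall w, rnorm (f w) <= C * rnorm w).

Lemma functional_linear f : functional f ->
  exists2 g : {linear W -> K^o}, continuous g & (g : W -> K) = f.
Proof.
move=> [fL [C fC]].
have fL' : linear (f : W -> K^o) by exact: fL.
pose g : {linear W -> K^o} := HB.pack (f : W -> K^o)
  (GRing.isLinear.Build _ _ _ _ (f : W -> K^o) fL').
exists g => //.
apply: bounded_linear_continuous; apply/linear_boundedP.
near=> r => w; rewrite rnormE [X in _ <= _ * X]rnormE.
apply: (@le_trans _ _ (ofR (`|C|) * ofR (rnorm w))).
  rewrite -ofRM ler_ofR (le_trans (fC w))// ler_wpM2r ?rnorm_ge0//.
  exact: ler_norm.
rewrite ler_wpM2r// -?ofR0 ?ler_ofR ?rnorm_ge0//.
near: r; apply: nbhs_pinfty_ge.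
by rewrite ger0_real// -ofR0 ler_ofR.
Unshelve. all: by end_near. Qed.


Lemma functional0 f : functional f -> f 0 = 0.
Proof.
move=> [fL _]; have := fL 1 0 0; rewrite scaler0 addr0 mul1r => /eqP.
by rewrite -subr_eq subrr => /eqP.
Qed.

Lemma functionalD f u v : functional f -> f (u + v) = f u + f v.
Proof. by move=> [fL _]; have := fL 1 u v; rewrite scale1r mul1r. Qed.

Lemma functionalZ f (a : K) u : functional f -> f (a *: u) = a * f u.
Proof.
by move=> ff; have [fL _] := ff; rewrite -[a *: u]addr0 fL functional0// addr0.
Qed.

Lemma functionalB f u v : functional f -> f (u - v) = f u - f v.
Proof.
by move=> ff; rewrite functionalD// -scaleN1r functionalZ// mulN1r.
Qed.

Lemma functional_cst0 : functional (fun _ : W => 0 : K).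
Proof.
split=> [a u v|]; first by rewrite mulr0 addr0.
by exists 0 => w; rewrite mul0r rnorm0.
Qed.

Lemma functional_axpy (a : K) f g : functional f -> functional g ->
  functional (fun w => a * f w + g w).
Proof.
move=> [fL [C fC]] [gL [D gD]]; split=> [b u v|].
  by rewrite fL gL; ring.
exists (rnorm a * C + D) => w.
rewrite (le_trans (rnormD _ _))// rnormM mulrDl lerD// -mulrA.
by rewrite ler_wpM2l ?rnorm_ge0.
Qed.

Lemma functional_sum (k : nat) (c : nat -> K) (F : nat -> W -> K) :
  (forall i, functional (F i)) -> functional (fun w => \sum_(i < k) c i * F i w).
Proof.
move=> FF; elim: k => [|k IH].
  under eq_fun do rewrite big_ord0.
  exact: functional_cst0.
under eq_fun do rewrite big_ord_recr/= addrC.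
exact: functional_axpy.
Qed.

End Hahn_Banach.

(** For complex scalars the real norming functional [p] is the real part of the complex-linear form
    sending [w] to [p w] minus [I] times [p (I *: w)]. *)
Lemma norming_functional (R : realType) (s : scalars)
    (W : normedModType (scalar_field R s)) (w0 : W) :
  exists f : W -> scalar_field R s, [/\ functional f,
    forall w, rnorm (f w) <= rnorm w & re (f w0) = rnorm w0].
Proof.
have [p [pD pZ pN p0]] := real_norming w0.
case: s W w0 p pD pZ pN p0 => W w0 p pD pZ pN p0.
  have pN' w : rnorm (p w : scalar_field R Reals) <= rnorm w.
    rewrite (_ : rnorm _ = `|p w|)// ler_norml pN andbT.
    have p00 : p 0 = 0 by have := pD 0 0; rewrite addr0; lra.
    have pNw : p (- w) = - p w by have := pD (- w) w; rewrite addNr p00; lra.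
    by rewrite lerNl -pNw -rnormN pN.
  exists p; split=> //; split; first by move=> a u v; rewrite pD -pZ.
  by exists 1 => w; rewrite mul1r.
pose K := scalar_field R Complexes.
pose I : K := Complex 0 1.
pose f w : K := Complex (p w) (- p (I *: w)).
have cE (c : K) : c = ofR (complex.Re c) + ofR (complex.Im c) * I.
  case: c => a b; apply/eqP; rewrite eq_complex/=.
  by rewrite !(mul0r, mulr0, mulr1, subr0, addr0, add0r) !eqxx.
have II : I * I = - 1.
  by apply/eqP; rewrite eq_complex/=; apply/andP; split; apply/eqP; ring.
have fL : forall (c : K) u v, f (c *: u + v) = c * f u + f v.
  move=> c u v; rewrite /f scalerDr !pD.
  have -> : p (c *: u) = complex.Re c * p u + complex.Im c * p (I *: u).
    by rewrite {1}[c]cE scalerDl -scalerA pD !pZ.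
  have -> : p (I *: (c *: u)) = complex.Re c * p (I *: u) - complex.Im c * p u.
    rewrite scalerA {1}[c]cE mulrDr mulrCA II [I * _]mulrC mulrN1 -ofRN.
    by rewrite scalerDl -scalerA pD !pZ mulNr.
  case: c => a b; apply/eqP; rewrite eq_complex/=.
  by apply/andP; split; apply/eqP; ring.
have fN w : rnorm (f w) <= rnorm w.
  have [f0|f0] := eqVneq (rnorm (f w)) 0; first by rewrite f0 rnorm_ge0.
  have f_gt0 : 0 < rnorm (f w) by rewrite lt_neqAle eq_sym f0 rnorm_ge0.
  (* Since [c] is the conjugate of [f w], the real part of [f (c *: w)] is [rnorm (f w) ^+ 2], and
     the bound on [p] at [c *: w] bounds the modulus of [f w]. *)
  pose c : K := Complex (re (f w)) (- im (f w)).
  have cN : rnorm c = rnorm (f w) by rewrite !rnorm_sqrt/= sqrrN.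
  have fE : rnorm (f w) ^+ 2 = re (f (c *: w)).
    rewrite -[c *: w]addr0 fL reD (_ : f 0 = 0) ?re0 ?addr0; last first.
      have := fL 1 0 0; rewrite scaler0 addr0 mul1r => /eqP.
      by rewrite -subr_eq subrr => /eqP.
    rewrite rnorm_sqrt sqr_sqrtr ?addr_ge0 ?sqr_ge0// reM/=.
    by rewrite mulNr opprK !expr2.
  have : rnorm (f w) ^+ 2 <= rnorm (f w) * rnorm w.
    by rewrite fE -cN -rnormZ; exact: pN.
  by rewrite expr2 ler_pM2l.
exists f; split=> //; split=> //.
by exists 1 => w; rewrite mul1r.
Qed.

(** * Rich subspaces of a normed space *)

Section rich_subspaces.
Context {R : realType} {s : scalars}.
Local Notation K := (scalar_field R s).
Context {W : normedModType K}.
Implicit Types (Z : closed_subspace W) (u v w x y : W).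

Lemma rnorm_quotient Z w :
  rnorm (quotient_map Z w) = quotient_rnorm (quotient_map Z w).
Proof. exact: re_ofR. Qed.

Lemma rnorm_quotient_lt Z w e : rnorm (quotient_map Z w) < e ->
  exists2 z, carrier Z z & rnorm (w - z) < e.
Proof.
rewrite rnorm_quotient -subr_gt0 => e0.
have [u /lprojP uw] := quotient_rnorm_adherent (quotient_map Z w) e0.
rewrite addrC subrK => ue; exists (w - u); last by rewrite opprB addrC subrK.
by apply/lprojP; apply/esym/lprojP.
Qed.

Lemma carrierZ Z (a : K) w : carrier Z w -> carrier Z (a *: w).
Proof. by move=> Zw; rewrite -[a *: w]addr0; apply: carrierP (carrier0 Z). Qed.

Lemma carrierD Z u v : carrier Z u -> carrier Z v -> carrier Z (u + v).
Proof. by move=> Zu Zv; rewrite -[u]scale1r; exact: carrierP. Qed.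

Lemma carrierB Z u v : carrier Z u -> carrier Z v -> carrier Z (u - v).
Proof. by move=> Zu Zv; apply: carrierD; rewrite // -scaleN1r; exact: carrierZ. Qed.

(** Narrowness of the quotient map in working form: smallness of [y - v] in the quotient is
    witnessed by an element of [Z] close to [y - v]. *)
Lemma rich_slice Z (f : W -> K) x y e a : rich Z -> functional f ->
  rnorm x = 1 -> rnorm y = 1 -> 0 < e -> a < re (f y) ->
  exists v z, [/\ rnorm v <= 1, a < re (f v), 2 - e < rnorm (x + v),
    carrier Z z & rnorm (y - v - z) < e].
Proof.
move=> [_ Zn] ff x1 y1 e0 ay; have [g gc gf] := functional_linear f ff.
have Sg : slice [set w : W | `|w| <= 1 /\ a < re (g w : K)].
  split; last by exists g, a.
  by exists y; split; [rewrite norm_le1 y1|rewrite -/(re ((g : W -> K) y)) gf].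
have [||||v [[v1 av] xv yv]] := Zn x y (ofR e) _ _ _ _ Sg.
- exact/norm_eq1.
- exact/norm_eq1.
- by rewrite -ofR0 ltr_ofR.
- by split; [rewrite norm_le1 y1|rewrite -/(re ((g : W -> K) y)) gf].
have [z Zz yvz] : exists2 z, carrier Z z & rnorm (y - v - z) < e.
  by apply: rnorm_quotient_lt; rewrite -norm_ltE.
exists v, z; split=> //; first by rewrite -norm_le1.
  by rewrite -gf.
by rewrite -norm_gtE ofRB ofR_nat.
Qed.

(** Almost additivity of the norm survives rescaling [x]: subtract [(r - 1) v] from [r (x + v)] when
    [r] exceeds 1, and [(1 - r) x] from [x + v] otherwise. It lets a new summand be added to a sum
    of norm [r]. *)
Lemma rnormD_scale x v r d : rnorm x = 1 -> rnorm v <= 1 -> 0 <= r ->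
  2 - d < rnorm (x + v) -> r + 1 - (r + 1) * d <= rnorm (ofR r *: x + v).
Proof.
move=> x1 v1 r0 xv.
have d0 : 0 < d by have := rnormD x v; lra.
have rd : 0 <= r * d by rewrite mulr_ge0// ltW.
have [r1|/ltW r1] := leP 1 r.
  have -> : ofR r *: x + v = ofR r *: (x + v) - ofR (r - 1) *: v.
    by rewrite scalerDr -addrA -scalerBl -ofRB subKr ofR1 scale1r.
  apply: le_trans (rnormBr _ _); rewrite !rnormZr !ger0_norm ?subr_ge0//.
  have : r * (2 - d) <= r * rnorm (x + v) by rewrite ler_wpM2l// ltW.
  have : (r - 1) * rnorm v <= (r - 1) * 1 by rewrite ler_wpM2l// subr_ge0.
  lra.
have -> : ofR r *: x + v = x + v - ofR (1 - r) *: x.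
  by rewrite addrAC -[X in X - _]scale1r -scalerBl -ofR1 -ofRB subKr.
apply: le_trans (rnormBr _ _); rewrite rnormZr ger0_norm ?subr_ge0// x1.
lra.
Qed.

(** * Averaging: control of finitely many functionals at once *)

Section weak_neighborhoods.
Context Z (Zr : rich Z) (k : nat) (F : nat -> W -> K).
Context (FF : forall i, functional (F i)).
Context (x y : W) (x1 : rnorm x = 1) (y1 : rnorm y = 1).

Let Q u := \sum_(i < k) re (F i u) ^+ 2.

Let Q_bounded : exists2 M, 0 <= M & forall u, rnorm u <= 2 -> Q u <= M.
Proof.
rewrite /Q; elim: k => [|j [M M0 MP]].
  by exists 0 => // u _; rewrite big_ord0.
have [_ [C FC]] := FF j.
exists (M + (`|C| * 2) ^+ 2) => [|u u2]; first by rewrite addr_ge0// sqr_ge0.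
rewrite big_ord_recr/= lerD ?MP//.
rewrite -[leLHS]real_normK ?num_real// ler_pXn2r ?nnegrE ?mulr_ge0//.
rewrite (le_trans (ler_re_rnorm _))// (le_trans (FC u))//.
rewrite (@le_trans _ _ (`|C| * rnorm u))// ?ler_wpM2l// ler_wpM2r ?rnorm_ge0//.
exact: ler_norm.
Qed.

(* The summands of V are chosen one after the other, each in the slice that
   makes the new deviation y - v point against the deviation y *+ n - V
   accumulated so far; so the squared deviation grows only linearly in n. *)
Let rich_sum M : 0 <= M -> (forall u, rnorm u <= 2 -> Q u <= M) ->
  forall n e, 0 < e -> exists V z, [/\ rnorm V <= n%:R,
    n%:R + 1 - e < rnorm (x + V), carrier Z z,
    rnorm (y *+ n - V - z) < e & Q (y *+ n - V) <= n%:R * (M + 1)].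
Proof.
move=> M0 MP; elim=> [|n IH] e e0.
  exists 0, 0; rewrite rnorm0 mulr0n addr0 !subr0 rnorm0 x1 add0r; split=> //.
  - by lra.
  - exact: carrier0.
  - rewrite mul0r /Q big1// => i _.
    by rewrite functional0// re0 expr0n.
have n0 : 0 <= n%:R :> R by [].
(* The bound [2^-1] keeps [rnorm (x + V)] positive, so that [x + V] can be normalised; [e / 2]
   leaves half of the error to the new summand. *)
pose e1 := Num.min (e / 2) 2^-1.
have e10 : 0 < e1 by rewrite /e1 lt_min; apply/andP; split; lra.
have [e1e e12] : e1 <= e / 2 /\ e1 <= 2^-1.
  by split; rewrite /e1 ge_min lexx ?orbT.
have [V [z [Vn xV Zz uz uQ]]] := IH _ e10.
set u := y *+ n - V in uz uQ.
pose r := rnorm (x + V).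
have r0 : 0 < r by rewrite /r; lra.
have rn : r <= n%:R + 1 by have := rnormD x V; rewrite -/r x1; lra.
have xVE : x + V = ofR r *: (ofR r^-1 *: (x + V)).
  by rewrite scaleofRA divff ?gt_eqF// ofR1 scale1r.
have x'1 : rnorm (ofR r^-1 *: (x + V)) = 1.
  by rewrite rnormZr gtr0_norm ?invr_gt0// mulVf// gt_eqF.
pose e2 := e / (2 * (n%:R + 2)).
have e20 : 0 < e2 by rewrite /e2 divr_gt0//; lra.
have e2E : (n%:R + 2) * e2 = e / 2 by rewrite /e2; field; lra.
pose c i : K := ofR (re (F i u)).
have Gf := functional_sum k c F FF.
set G := (fun w => _) in Gf.
(* The cross term of the squared deviation is twice [re (G y) - re (G v)], hence less than 1 on this
   slice; this is the 1 in the increment [M + 1]. *)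
have ay : re (G y) - 2^-1 < re (G y) by lra.
have [v [z' [v1 Gv xv Zz' vz']]] := rich_slice Z G _ y e2 _ Zr Gf x'1 y1 e20 ay.
exists (V + v), (z + z').
have dE : y *+ n.+1 - (V + v) = u + (y - v).
  by rewrite mulrSr /u opprD addrACA.
split.
- by rewrite (le_trans (rnormD _ _))// -natr1 lerD.
- have := rnormD_scale _ v r e2 x'1 v1 (ltW r0) xv.
  rewrite -xVE addrA -natr1.
  have : (r + 1) * e2 <= (n%:R + 2) * e2 by rewrite ler_wpM2r//; lra.
  have : n%:R + 1 - e1 < r by [].
  lra.
- exact: carrierD.
- rewrite dE opprD addrACA (le_lt_trans (rnormD _ _))//.
  have : e2 <= e / 2.
    rewrite -e2E ler_peMl//; lra.
  lra.
- have GE : \sum_(i < k) re (F i u) * re (F i (y - v)) = re (G y) - re (G v).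
    rewrite -reB -functionalB// /G; elim/big_ind2: _ => //.
    + by rewrite re0.
    + by move=> a b c' d -> ->; rewrite reD.
    + by move=> i _; rewrite reMofR.
  have yv2 : rnorm (y - v) <= 2 by have := rnormB y v; rewrite y1; lra.
  have -> : Q (y *+ n.+1 - (V + v)) = Q u +
      2 * (\sum_(i < k) re (F i u) * re (F i (y - v))) + Q (y - v).
    rewrite dE /Q mulr_sumr -!big_split/=; apply: eq_bigr => i _.
    by rewrite (functionalD _ u (y - v))// (reD (F i u)); ring.
  have := MP _ yv2; rewrite GE -natr1; lra.
Qed.

(** The sum [V] of [rich_sum] is divided by its number of summands [t]. The squared deviation grows
    at most like [t * (M + 1)] but is divided by [t ^+ 2], so it drops below [e ^+ 2] once [t] is
    large. *)
Lemma rich_weak e : 0 < e -> exists v z, [/\ rnorm v <= 1,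
  2 - e < rnorm (x + v), carrier Z z, rnorm (y - v - z) < e &
  forall i, (i < k)%N -> `|re (F i (y - v))| < e].
Proof.
move=> e0; have [M M0 MP] := Q_bounded.
have [n nE] : exists n, (M + 1) / e ^+ 2 < n.+1%:R.
  exists (Num.bound ((M + 1) / e ^+ 2)).
  rewrite -natr1 (lt_trans (archi_boundP _)) ?ltrDl//.
  by rewrite divr_ge0 ?sqr_ge0//; lra.
have [V [z [Vn xV Zz uz uQ]]] := rich_sum M M0 MP n.+1 e e0.
pose t : R := n.+1%:R.
have t1 : 1 <= t by rewrite /t -natr1 lerDr.
have t0 : 0 < t by lra.
have yE : y = ofR t^-1 *: (y *+ n.+1).
  rewrite -scaler_nat -ofR_nat scaleofRA mulVf ?gt_eqF//.
  by rewrite ofR1 scale1r.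
have tV : 0 <= t^-1 <= 1 by rewrite invr_ge0 ltW//= invf_le1.
have [tV0 tV1] := andP tV.
have vE : y - ofR t^-1 *: V = ofR t^-1 *: (y *+ n.+1 - V).
  by rewrite {1}yE -scalerBr.
have V1 : rnorm (ofR t^-1 *: V) <= 1.
  by rewrite rnormZr ger0_norm// ler_pdivrMl// mulr1.
exists (ofR t^-1 *: V), (ofR t^-1 *: z); split=> //.
(* The subtracted multiple of [V] has norm at most [t - 1], while [x + V] has norm above
   [t + 1 - e]. *)
- have -> : x + ofR t^-1 *: V = x + V - ofR (1 - t^-1) *: V.
    by rewrite ofRB scalerBl ofR1 scale1r opprB addrACA subrr addr0.
  apply: lt_le_trans (rnormBr _ _); rewrite rnormZr ger0_norm ?subr_ge0//.
  have : (1 - t^-1) * rnorm V <= t - 1.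
    apply: (@le_trans _ _ ((1 - t^-1) * t)).
      by rewrite ler_wpM2l// subr_ge0.
    by rewrite mulrBl mulVf ?gt_eqF// mul1r.
  have : t + 1 - e < rnorm (x + V) by [].
  by move: (rnorm (x + V)) ((1 - t^-1) * rnorm V) => p q; lra.
- exact: carrierZ.
- rewrite vE -scalerBr rnormZr ger0_norm//.
  rewrite (le_lt_trans _ uz)// ler_piMl ?rnorm_ge0//.
- move=> i ik; rewrite vE functionalZ// reMofR normrM (ger0_norm tV0).
  rewrite ltr_pdivrMl// -(ltr_pXn2r (ltn0Sn 1)) ?nnegrE ?normr_ge0//;
    last by rewrite (mulr_ge0 (ltW t0) (ltW e0)).
  rewrite real_normK ?num_real//.
  have : re (F i (y *+ n.+1 - V)) ^+ 2 <= Q (y *+ n.+1 - V).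
    rewrite /Q (bigD1 (Ordinal ik))//= lerDl sumr_ge0// => j _.
    exact: sqr_ge0.
  move=> /le_trans => /(_ _ uQ) /le_lt_trans; apply.
  rewrite exprMn -/t [t ^+ 2]expr2 -mulrA ltr_pM2l//.
  by move: nE; rewrite ltr_pdivrMr ?exprn_gt0.
Qed.

End weak_neighborhoods.

End rich_subspaces.

(** * Passing from a rich subspace to its one-codimensional subspaces *)

Section one_codimensional.
Context {R : realType} {s : scalars}.
Local Notation K := (scalar_field R s).

(** [rich_weak] controls real parts only; listing [m * f] next to [f] controls the imaginary part of
    [f] as well. *)
Lemma im_re_mul : exists m : K, forall z, im z = re (m * z).
Proof.
case: s => /=; first by exists 0 => z; rewrite mul0r.
by exists (Complex 0 (-1)) => -[a b] /=; rewrite mul0r sub0r mulN1r opprK.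
Qed.

Lemma rnorm_le_re_im (z : K) : rnorm z <= `|re z| + `|im z|.
Proof.
rewrite rnorm_sqrt -(ler_pXn2r (ltn0Sn 1)) ?nnegrE ?sqrtr_ge0 ?addr_ge0//.
rewrite sqr_sqrtr ?addr_ge0 ?sqr_ge0// sqrrD !real_normK ?num_real//.
by rewrite lerD2r lerDl mulrn_wge0// mulr_ge0.
Qed.

Context {W : normedModType K}.
Implicit Types (X Y Z : closed_subspace W) (u v w x y : W).

Lemma separating_functional Y x0 : ~ carrier Y x0 -> exists f : W -> K,
  [/\ functional f, forall y, carrier Y y -> f y = 0 & 0 < re (f x0)].
Proof.
move=> Yx0; have [g [gf gN gx0]] := norming_functional _ _ _ (quotient_map Y x0).
have [gL _] := gf.
exists (g \o quotient_map Y); split=> /=.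
- split=> [a u v|]; first by rewrite /= linearP gL.
  exists 1 => w; rewrite mul1r (le_trans (gN _))// rnorm_quotient.
  exact: quotient_rnorm_le.
- move=> y Yy; rewrite (_ : quotient_map Y y = 0) ?functional0//.
  by rewrite -(raddf0 (quotient_map Y)); apply/lprojP; rewrite subr0.
- rewrite gx0 rnorm_gt0; apply/eqP; rewrite -(raddf0 (quotient_map Y)).
  by move/lprojP; rewrite subr0.
Qed.

(** First [v1] is found for [x1] and [y], then [v] for [x2] and the normalised [v1]. Keeping a
    norming functional [g] of [x1 + v1] almost unchanged in the second step keeps the norm of
    [x1 + v] close to 2. *)
Lemma rich_two_points X (f : W -> K) x1 x2 y e : rich X -> functional f ->
  rnorm x1 = 1 -> rnorm x2 = 1 -> rnorm y = 1 -> 0 < e ->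
  exists v z, [/\ rnorm v <= 1, 2 - e < rnorm (x1 + v), 2 - e < rnorm (x2 + v),
    carrier X z & rnorm (y - v - z) < e /\ rnorm (f (y - v)) < e].
Proof.
move=> Xr ff x11 x21 y1 e0; have [_ [C fC]] := ff; have [m mE] := im_re_mul.
have mf : functional (fun w => m * f w).
  have := functional_axpy m f (fun=> 0) ff functional_cst0.
  by under eq_fun do rewrite addr0.
(* The largest error is that of [f (y - v)]: [2 * d] from each use of [rich_weak], through real and
   imaginary parts, and [|C| * d] from normalising [v1]. *)
pose D := `|C| + 5.
have C0 : 0 <= `|C| by [].
have fC' w : rnorm (f w) <= `|C| * rnorm w.
  by rewrite (le_trans (fC w))// ler_wpM2r ?rnorm_ge0// ler_norm.
pose d := Num.min 2^-1 (e / D).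
have D0 : 0 < D by rewrite /D; lra.
have d0 : 0 < d by rewrite /d lt_min divr_gt0// andbT; lra.
have d2 : d <= 2^-1 by rewrite /d ge_min lexx.
have dD : d * D <= e by rewrite -ler_pdivlMr// /d ge_min lexx orbT.
have Cd : d * D = `|C| * d + 5 * d by rewrite /D; ring.
have Cd0 : 0 <= `|C| * d by rewrite mulr_ge0// ltW.
pose F1 i := if i is 0%N then f else fun w => m * f w.
have [|v1 [z1 [v11 xv1 Xz1 yz1 F1v]]] :=
  @rich_weak _ _ _ X Xr 2 F1 _ x1 y x11 y1 d d0.
  by case.
have v1d : 1 - d < rnorm v1 by have := rnormD x1 v1; lra.
have v10 : 0 < rnorm v1 by lra.
have [g [gf gN gv1]] := norming_functional _ _ _ (x1 + v1).
pose y' := ofR (rnorm v1)^-1 *: v1.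
have y'1 : rnorm y' = 1.
  by rewrite rnormZr gtr0_norm ?invr_gt0// mulVf// gt_eqF.
have y'v1 : rnorm (v1 - y') <= d.
  have -> : v1 - y' = ofR (rnorm v1 - 1) *: y'.
    by rewrite ofRB scalerBl ofR1 scale1r /y' scaleofRA divff ?gt_eqF// ofR1 scale1r.
  by rewrite rnormZr y'1 mulr1 ler_norml; apply/andP; split; lra.
pose F2 i := match i with 0%N => f | 1%N => fun w => m * f w | _ => g end.
have [|v [z2 [v21 xv Xz2 yz2 F2v]]] :=
  @rich_weak _ _ _ X Xr 3 F2 _ x2 y' x21 y'1 d d0.
  by case=> [//|[]//].
exists v, (z1 + z2); split=> //.
- have : re (g (x1 + v1)) - re (g (v1 - y')) - re (g (y' - v)) = re (g (x1 + v)).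
    rewrite -!reB -!functionalB//; congr (re (g _)).
    by rewrite -addrA -opprD subrKA opprB -addrA [v1 + _]addrC subrK.
  have := ler_re_rnorm (g (x1 + v)); have := gN (x1 + v).
  have /= := F2v 2%N erefl.
  have := ler_re_rnorm (g (v1 - y')); have := gN (v1 - y').
  rewrite ltr_norml gv1 => ? ? /andP[? ?] ? ? ?.
  have := ler_norm (re (g (x1 + v))); have := ler_norm (re (g (v1 - y'))); lra.
- lra.
- exact: carrierD.
split.
- have -> : y - v - (z1 + z2) = (y - v1 - z1) + (v1 - y') + (y' - v - z2).
    by rewrite (addrAC (y - v1)) addrACA -opprD !subrKA.
  have := rnormD (y - v1 - z1 + (v1 - y')) (y' - v - z2).
  have := rnormD (y - v1 - z1) (v1 - y'); lra.
- have -> : y - v = (y - v1) + (v1 - y') + (y' - v) by rewrite !subrKA.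
  rewrite (functionalD f (y - v1 + (v1 - y')))//.
  rewrite (functionalD f (y - v1) (v1 - y'))//.
  have := rnormD (f (y - v1) + f (v1 - y')) (f (y' - v)).
  have := rnormD (f (y - v1)) (f (v1 - y')).
  have := rnorm_le_re_im (f (y - v1)); have := rnorm_le_re_im (f (y' - v)).
  rewrite !mE; have /= := F1v 0%N erefl; have /= := F1v 1%N erefl.
  have /= := F2v 0%N erefl; have /= := F2v 1%N erefl.
  have := fC' (v1 - y').
  have : `|C| * rnorm (v1 - y') <= `|C| * d by rewrite ler_wpM2l.
  lra.
Qed.

(** With [f] vanishing on [Y] but not at [x0], the element [z] of [X] near [y - v] has small [f z].
    Since [f z = a * f x0] for the [a] with [z - a *: x0] in [Y], moving [z] into [Y] costs
    little. *)
Lemma rich_two_points_one_codimensional X Y x1 x2 y e :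
  rich X -> one_codimensional X Y ->
  rnorm x1 = 1 -> rnorm x2 = 1 -> rnorm y = 1 -> 0 < e ->
  exists v z, [/\ rnorm v <= 1, 2 - e < rnorm (x1 + v), 2 - e < rnorm (x2 + v),
    carrier Y z & rnorm (y - v - z) < e].
Proof.
move=> Xr [_ [x0 [Xx0 Yx0] XY]] x11 x21 y1 e0.
have [f [ff fY fx0]] := separating_functional Y x0 Yx0.
have [_ [C fC]] := ff.
have p0 : 0 < rnorm (f x0).
  by rewrite (lt_le_trans fx0)// (le_trans (ler_norm _))// ler_re_rnorm.
set p := rnorm (f x0) in p0.
pose D := 1 + (1 + `|C|) / p * rnorm x0.
have q0 : 0 <= (1 + `|C|) / p by rewrite divr_ge0 ?addr_ge0// ltW.
have D1 : 1 <= D by rewrite /D lerDl mulr_ge0 ?rnorm_ge0.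
have D0 : 0 < D by lra.
have d0 : 0 < e / D by rewrite divr_gt0.
have de : e / D <= e by rewrite ler_pdivrMr// ler_peMr// ltW.
have [v [z [v1 x1v x2v Xz [vz fv]]]] :=
  rich_two_points X f x1 x2 y _ Xr ff x11 x21 y1 d0.
have [a Yza] := XY _ Xz.
exists v, (z - a *: x0); split=> //; [lra|lra|].
have fz : f z = a * f x0.
  apply/eqP; rewrite -subr_eq0 -functionalZ// -functionalB//.
  by rewrite fY.
have aE : rnorm a * p <= (1 + `|C|) * (e / D).
  rewrite /p -rnormM -fz.
  have -> : z = (y - v) - (y - v - z) by rewrite subKr.
  rewrite functionalB// (le_trans (rnormB _ _))// mulrDl mul1r lerD//.
    exact: ltW.
  rewrite (le_trans (fC _))// (@le_trans _ _ (`|C| * rnorm (y - v - z)))//.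
    by rewrite ler_wpM2r ?rnorm_ge0// ler_norm.
  by rewrite ler_wpM2l// ltW.
rewrite opprB addrA addrAC (le_lt_trans (rnormD _ _))// rnormZ.
rewrite -ler_pdivlMr// in aE.
have : rnorm a * rnorm x0 <= (1 + `|C|) * (e / D) / p * rnorm x0.
  by rewrite ler_wpM2r ?rnorm_ge0.
have : e / D + (1 + `|C|) * (e / D) / p * rnorm x0 = e.
  rewrite [X in X + _](_ : _ = (e / D) * 1) ?mulr1//.
  transitivity (e / D * D); last by rewrite divfK// gt_eqF.
  by rewrite {4}/D; ring.
lra.
Qed.

End one_codimensional.

(** * Integrals of real functions on a probability space *)

Section real_integrals.
Context {R : realType} {d : measure_display} {T : measurableType d}.
Context (P : probability T R).
Implicit Types (f g : T -> R) (c : R).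

Definition rintegrable f := P.-integrable setT (EFin \o f).

Lemma rintegrable_cst c : rintegrable (fun=> c).
Proof. exact: finite_measure_integrable_cst. Qed.

Lemma rintegrable_indic (A : set T) : measurable A -> rintegrable \1_A.
Proof. exact: integrable_indic. Qed.

Lemma rintegrableD f g : rintegrable f -> rintegrable g ->
  rintegrable (fun t => f t + g t).
Proof. exact: integrableD. Qed.

Lemma rintegrableB f g : rintegrable f -> rintegrable g ->
  rintegrable (fun t => f t - g t).
Proof. exact: integrableB. Qed.

Lemma rintegrableZ c f : rintegrable f -> rintegrable (fun t => c * f t).
Proof. exact: integrableZl. Qed.

Lemma Rintegral_probability_cst c : \int[P]_t c = c.
Proof.
by rewrite Rintegral_cst// (_ : fine _ = 1) ?mulr1// [X in fine X]probability_setT.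
Qed.

Lemma Rintegral_indic (A : set T) : measurable A -> \int[P]_t \1_A t = fine (P A).
Proof. by move=> mA; rewrite /Rintegral integral_indic// setIT. Qed.

Lemma chebyshev_set (A : set T) f c : measurable A -> rintegrable f ->
  (forall t, 0 <= f t) -> (forall t, A t -> c <= f t) ->
  c * fine (P A) <= \int[P]_t f t.
Proof.
move=> mA fi f0 cf; have iA := rintegrable_indic A mA.
rewrite -Rintegral_indic// -RintegralZl//.
apply: le_Rintegral => //; first exact: rintegrableZ.
move=> t _; rewrite indicE; case: (boolP (t \in A)) => [/set_mem At|_].
  by rewrite mulr1 cf.
by rewrite mulr0.
Qed.

Lemma integrable_tail f (e : R) : rintegrable f -> 0 < e ->
  exists n : nat, rintegrable (fun t => Num.max (f t - n%:R) 0) /\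
    \int[P]_t Num.max (f t - n%:R) 0 < e.
Proof.
move=> fi e0; have mf := measurable_int _ fi.
pose F n t : \bar R := (Num.max (f t - n%:R) 0)%:E.
have mF n : measurable_fun setT (F n).
  apply/measurable_EFinP; apply: measurable_maxr => //.
  by apply: measurable_funB => //; exact/measurable_EFinP.
have FN n t : (`|F n t| <= `|(f t)%:E|)%E.
  rewrite lee_fin ger0_norm ?le_max ?lexx ?orbT//.
  rewrite ge_max normr_ge0 andbT (le_trans _ (ler_norm _))//.
  by rewrite lerBlDr lerDl.
have iF n : P.-integrable setT (F n).
  by apply: le_integrable fi => // t _; exact: FN.
have /fine_cvgP[_] : (\int[P]_t F n t)%E @[n --> \oo] --> (0%R)%:E.
  rewrite (_ : 0%:E = \int[P]_t cst 0 t)%E; last by rewrite integral0.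
  apply: (@dominated_cvg _ _ _ _ _ _ _ _ (abse \o (EFin \o f))) => //.
  - move=> t _; apply: cvg_near_cst.
    near=> n; congr EFin; apply/max_idPr; rewrite subr_le0.
    by near: n; exact: nbhs_infty_ger.
  - exact: integrable_abse.
move/cvgr_lt => /(_ e e0) [n _ /(_ n (leqnn n)) nE].
by exists n; split=> //; exact: iF.
Unshelve. all: by end_near. Qed.

End real_integrals.

(** * Norm and smallness in measure in [L1] *)

Section L1_theory.
Context {R : realType} {s : scalars} {d : measure_display}.
Context {T : measurableType d} {P : probability T R}.
Local Notation K := (scalar_field R s).
Local Notation L1P := (L1 s P).
Implicit Types (f g h x v : L1P) (e : R).

Lemma rnorm_L1_class (f : integrable_fun s P) :
  rnorm (L1_class f) = \int[P]_t rnorm (f t : K).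
Proof. by rewrite -L1_rnormE; exact: re_ofR. Qed.

Lemma rnorm_L1 f : rnorm f = \int[P]_t rnorm (L1_val f t : K).
Proof. by rewrite -rnorm_L1_class L1_valK. Qed.

Lemma rnorm_L1D f g : rnorm (f + g) = \int[P]_t rnorm (L1_val f t + L1_val g t : K).
Proof. by rewrite -{1}[f]L1_valK -{1}[g]L1_valK -raddfD rnorm_L1_class. Qed.

Definition small_in_measure e h : Prop :=
  (P [set t | (e <= rnorm (L1_val h t : K))%R] < e%:E)%E.

Lemma measurable_rnorm_superlevel (f : integrable_fun s P) e :
  measurable [set t | (e <= rnorm (f t : K))%R].
Proof.
have := measurable_rnorm_ge f 0 e.
by congr measurable; apply/seteqP; split=> t /=; rewrite subr0.
Qed.

Lemma small_in_measure_class (f : integrable_fun s P) e :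
  small_in_measure e (L1_class f) <->
  (P [set t | (e <= rnorm (f t : K))%R] < e%:E)%E.
Proof.
rewrite /small_in_measure; have := L1_classK f.
move: (L1_val (L1_class f)) => k ae.
suff -> : P [set t | (e <= rnorm (k t : K))%R] =
    P [set t | (e <= rnorm (f t : K))%R] by [].
have mk := measurable_rnorm_superlevel k e.
have mf := measurable_rnorm_superlevel f e.
rewrite -[X in P X = _]setIT -[X in _ = P X]setIT -!integral_indic//.
apply: ae_eq_integral => //.
- exact/measurable_EFinP/measurable_indic.
- exact/measurable_EFinP/measurable_indic.
- apply: filterS ae => t kt _; rewrite !indicE; congr (nat_of_bool _)%:R%:E.
  by apply/idP/idP => /set_mem/= H; apply/mem_set => /=; move: H; rewrite kt.
Qed.

Lemma small_in_measureB f g e : small_in_measure e (f - g) <->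
  (P [set t | (e <= rnorm (L1_val f t - L1_val g t : K))%R] < e%:E)%E.
Proof.
rewrite -{1}[f]L1_valK -{1}[g]L1_valK -raddfB.
exact: small_in_measure_class.
Qed.

Lemma small_in_measureN h e : small_in_measure e h -> small_in_measure e (- h).
Proof.
rewrite -[h]subr0 opprB => /small_in_measureB/(@measure_ball_sym _ s _ _ P h 0 e).
by move=> h0; apply/small_in_measureB.
Qed.

Lemma small_in_measureD h1 h2 e1 e2 : small_in_measure e1 h1 ->
  small_in_measure e2 h2 -> small_in_measure (e1 + e2) (h1 + h2).
Proof.
move=> s1 /small_in_measureN s2; rewrite -[h2]opprK; apply/small_in_measureB.
apply: (@measure_ball_triangle _ s _ _ P h1 0 (- h2)).
  by apply/small_in_measureB; rewrite subr0.
by apply/(@measure_ball_sym _ s _ _ P (- h2) 0)/small_in_measureB; rewrite subr0.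
Qed.

Lemma small_in_measureZ (a : K) h e c : 0 < e -> 1 <= c -> rnorm a <= c ->
  small_in_measure e h -> small_in_measure (c * e) (a *: h).
Proof.
move=> e0 c1 ac sh; rewrite -[h]L1_valK -linearZ; apply/small_in_measure_class.
apply: (@le_lt_trans _ _ (P [set t | (e <= rnorm (L1_val h t : K))%R])).
  apply: le_measure; rewrite ?inE; [exact: measurable_rnorm_superlevel..|].
  move=> t /=; rewrite -[(a *: _) t]/(a *: (L1_val h t : K^o)) rnormZ => ce.
  have c0 : 0 < c by rewrite (lt_le_trans _ c1).
  rewrite -(ler_pM2l c0) (le_trans ce)// ler_wpM2r ?rnorm_ge0//.
by rewrite (lt_le_trans sh)// lee_fin ler_peMl// ltW.
Qed.

Lemma le_small_in_measure h e e' : e <= e' ->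
  small_in_measure e h -> small_in_measure e' h.
Proof.
move=> ee' sh; apply: (le_lt_trans _ (lt_le_trans sh _)); last by rewrite lee_fin.
apply: le_measure; rewrite ?inE; [exact: measurable_rnorm_superlevel..|].
by move=> t /=; exact: le_trans.
Qed.

Lemma fine_probability (A : set T) e : measurable A ->
  (P A < e%:E)%E <-> fine (P A) < e.
Proof.
by move=> mA; rewrite -lte_fin fineK// fin_num_measure.
Qed.

Lemma rintegrable_rnorm (f : integrable_fun s P) :
  rintegrable P (fun t => rnorm (f t : K)).
Proof. exact: integrable_rnorm. Qed.

Lemma markov_small h e : 0 < e -> rnorm h < e ^+ 2 -> small_in_measure e h.
Proof.
move=> e0 he; have mA := measurable_rnorm_superlevel (L1_val h) e.
apply/fine_probability => //.
have := chebyshev_set P _ _ e mA (rintegrable_rnorm (L1_val h))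
  (fun t => rnorm_ge0 _) (fun t => id).
rewrite -rnorm_L1 => /le_lt_trans /(_ he).
by rewrite expr2 ltr_pM2l.
Qed.

(** The pointwise loss in the triangle inequality is at most twice the smaller modulus. That is
    below [2 * c] where [h] is small, and on the remaining set [B], of measure below [c], it is at
    most [2 * (n + m t)], with [m] the integrable excess of [x] over the level [n]. *)
Lemma almost_disjoint x e : 0 < e -> exists2 c, 0 < c &
  forall h, small_in_measure c h -> rnorm x + rnorm h - e <= rnorm (x + h).
Proof.
move=> e0; have e80 : 0 < e / 8 by rewrite divr_gt0.
have xi := rintegrable_rnorm (L1_val x).
have [n [mi mE]] := integrable_tail P _ _ xi e80.
set m := (fun t => Num.max _ _) in mi mE.
pose c := e / 8 / n.+1%:R.
have c0 : 0 < c by rewrite divr_gt0.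
have cE : n%:R * c + c = e / 8.
  by rewrite -[X in _ + X]mul1r -mulrDl natr1 /c mulrC divfK.
exists c => // h /fine_probability sh.
set B := [set t | _] in sh.
have mB : measurable B by exact: measurable_rnorm_superlevel.
have {}sh := sh mB.
have hi := rintegrable_rnorm (L1_val h).
have Bi := rintegrableZ P n%:R _ (rintegrable_indic P B mB).
have xhi := rintegrable_rnorm (L1_val x + L1_val h).
have ci := rintegrable_cst P c.
have Ki := rintegrableZ P 2 _ (rintegrableD P _ _ (rintegrableD P _ _ ci Bi) mi).
have : \int[P]_t (rnorm (L1_val x t : K) + rnorm (L1_val h t : K)
    - 2 * (c + n%:R * \1_B t + m t)) <= rnorm (x + h).
  rewrite rnorm_L1D; apply: le_Rintegral => //.
    exact: rintegrableB (rintegrableD P _ _ xi hi) Ki.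
  move=> t _; rewrite indicE.
  have m0 : 0 <= m t by rewrite /m le_max lexx orbT.
  have mx : rnorm (L1_val x t : K) - n%:R <= m t by rewrite /m le_max lexx.
  have := rnormDr (L1_val x t : K) (L1_val h t).
  have := rnormDr (L1_val h t : K) (L1_val x t); rewrite [_ + L1_val x t]addrC.
  case: (boolP (t \in B)) => [_|/negP tB] /=; first by rewrite mulr1; lra.
  have : rnorm (L1_val h t : K) < c.
    by rewrite ltNge; apply/negP => ?; apply: tB; exact/mem_set.
  rewrite mulr0; lra.
rewrite RintegralB//; last exact: (rintegrableD P _ _ xi hi).
rewrite RintegralD// -!rnorm_L1 RintegralZl//; last first.
  exact: (rintegrableD P _ _ (rintegrableD P _ _ ci Bi) mi).
rewrite RintegralD//; last exact: (rintegrableD P _ _ ci Bi).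
rewrite RintegralD// Rintegral_probability_cst RintegralZl//; last first.
  exact: rintegrable_indic.
rewrite Rintegral_indic//.
have : n%:R * fine (P B) <= n%:R * c by rewrite ler_wpM2l// ltW.
lra.
Qed.

Lemma sintegrable_cst1 : (cst 1 : T -> K^o) \in sintegrable_pred P.
Proof.
have [m1 mi] : re (1 : K) = 1 /\ im (1 : K) = 0.
  by rewrite -ofR1 re_ofR im_ofR.
apply/mem_set; split.
  by rewrite (_ : _ \o _ = EFin \o cst (re (1 : K)))//; exact: rintegrable_cst.
by rewrite (_ : _ \o _ = EFin \o cst (im (1 : K)))//; exact: rintegrable_cst.
Qed.

Definition L1_one : L1P := L1_class (IntegrableFun sintegrable_cst1).

Lemma rnorm1 : rnorm (1 : K) = 1.
Proof. by rewrite -ofR1 rnorm_ofR normr1. Qed.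

Lemma rnorm_L1_one : rnorm L1_one = 1.
Proof.
rewrite rnorm_L1_class -[RHS](Rintegral_probability_cst P).
by apply: eq_Rintegral => t _; exact: rnorm1.
Qed.

(** A quantitative form of the fact that 1 and -1 cannot both be aligned with a nonzero scalar; it
    rests on the parallelogram identity. *)
Lemma rnorm_add_sub1 (z : K) (c : R) : 0 <= c -> c <= rnorm z ->
  2 * (c / (1 + c)) <= 2 + 2 * rnorm z - rnorm (1 + z) - rnorm (1 - z).
Proof.
move=> c0 cz; set a := rnorm z; set p := rnorm (1 + z); set q := rnorm (1 - z).
have a0 : 0 <= a by exact: rnorm_ge0.
have p0 : 0 <= p by exact: rnorm_ge0.
have q0 : 0 <= q by exact: rnorm_ge0.
have parallelogram : p ^+ 2 + q ^+ 2 = 2 + 2 * a ^+ 2.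
  rewrite /p /q /a !rnorm_sqrt !sqr_sqrtr ?addr_ge0 ?sqr_ge0//.
  by rewrite -ofR1 !reD !imD reN imN re_ofR im_ofR; ring.
(* Chosen so that [b * (1 + a) = a], which cancels the term [2 * a] in the square of [1 + a - b]. *)
pose b := a / (1 + a).
have bE : b * (1 + a) = a by rewrite /b divfK// gt_eqF//; lra.
have cb : c / (1 + c) <= b.
  rewrite /b ler_pdivrMr; last by lra.
  rewrite mulrAC ler_pdivlMr; [|lra].
  by rewrite !mulrDr !mulr1 [c * a]mulrC lerD2r.
suff : p + q <= 2 * (1 + a - b) by lra.
have b0 : 0 <= b by rewrite divr_ge0//; lra.
have ba : b <= 1 by rewrite ler_pdivrMr; lra.
rewrite -(ler_pXn2r (ltn0Sn 1)) ?nnegrE ?addr_ge0//; last by lra.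
have : 0 <= (p - q) ^+ 2 by exact: sqr_ge0.
have : 0 <= b ^+ 2 by exact: sqr_ge0.
have : (2 * (1 + a - b)) ^+ 2 = 4 * (1 + a ^+ 2 + 2 * a - 2 * (b * (1 + a)) + b ^+ 2).
  by ring.
rewrite bE => ->.
have : (p + q) ^+ 2 + (p - q) ^+ 2 = 2 * (p ^+ 2 + q ^+ 2) by ring.
rewrite parallelogram; lra.
Qed.

(** The defect of [rnorm_add_sub1] has integral below [2 * c], yet it is at least [2 * b] wherever
    [v] has modulus at least [e]; Chebyshev's inequality with [c = e * b] bounds the measure of that
    set. *)
Lemma small_of_rnorm_add_sub_one e : 0 < e -> exists2 c, 0 < c &
  forall v, rnorm v <= 1 -> 2 - c < rnorm (L1_one + v) ->
    2 - c < rnorm (- L1_one + v) -> small_in_measure e v.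
Proof.
move=> e0; pose b := e / (1 + e).
have b0 : 0 < b by rewrite divr_gt0//; lra.
exists (e * b); first exact: mulr_gt0.
move=> v v1 v1p; rewrite [- _ + v]addrC rnorm_distC => v1m.
set V := L1_val v.
have mA := measurable_rnorm_superlevel V e.
apply/fine_probability => //.
pose one := IntegrableFun sintegrable_cst1.
have vi := rintegrable_rnorm V.
have pi := rintegrable_rnorm (one + V).
have mi := rintegrable_rnorm (one - V).
have pE : rnorm (L1_one + v) = \int[P]_t rnorm ((one + V) t : K).
  by rewrite -[v]L1_valK -raddfD rnorm_L1_class.
have mE : rnorm (L1_one - v) = \int[P]_t rnorm ((one - V) t : K).
  by rewrite -[v]L1_valK -raddfB rnorm_L1_class.
have i2 := rintegrableD P _ _ (rintegrable_cst P 2) (rintegrableZ P 2 _ vi).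
have i3 := rintegrableB P _ _ i2 pi.
have := chebyshev_set P _ _ (2 * b) mA (rintegrableB P _ _ i3 mi).
rewrite !RintegralB// RintegralD//; last 2 first.
- exact: rintegrable_cst.
- exact: rintegrableZ.
rewrite Rintegral_probability_cst RintegralZl// -pE -mE -rnorm_L1.
have pw t c : 0 <= c -> c <= rnorm (V t : K) -> 2 * (c / (1 + c)) <=
    2 + 2 * rnorm (V t : K) - rnorm ((one + V) t : K) - rnorm ((one - V) t : K).
  exact: rnorm_add_sub1.
have p1 : forall t, 0 <= 2 + 2 * rnorm (V t : K) - rnorm ((one + V) t : K) -
    rnorm ((one - V) t : K).
  by move=> t; have := pw t 0 (lexx 0) (rnorm_ge0 _); rewrite mul0r mulr0.
have p2 t := pw t e (ltW e0).
move=> /(_ p1 p2) bP.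
rewrite -(ltr_pM2l b0) [b * e]mulrC.
lra.
Qed.

End L1_theory.

(** * Kernels as one-codimensional subspaces *)

Section codimension_one.
Context {R : realType} {s : scalars}.
Local Notation K := (scalar_field R s).
Context {W : normedModType K}.
Implicit Types (X Y : closed_subspace W).

Section kernel.
Context X (f : {linear W -> K^o}) (fc : continuous f).

Let ker0 : (carrier X `&` [set w | f w = 0]) 0.
Proof. by split; [exact: carrier0|rewrite /= linear0]. Qed.

Let kerP (a : K) u v : (carrier X `&` [set w | f w = 0]) u ->
  (carrier X `&` [set w | f w = 0]) v ->
  (carrier X `&` [set w | f w = 0]) (a *: u + v).
Proof.
move=> [Xu fu] [Xv fv]; split; first exact: carrierP.
by rewrite /= linearP fu fv scaler0 addr0.
Qed.

Let ker_closed : closed (LinearSubspace ker0 kerP).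
Proof.
apply: closedI; first exact: sub_closed.
apply: (@closed_comp _ _ f [set 0]) => [w _|]; first exact: fc.
exact/accessible_closed_set1/hausdorff_accessible/norm_hausdorff.
Qed.

Definition kernel_in : closed_subspace W := ClosedSubspace ker_closed.

Lemma kernel_in_one_codimensional x0 : carrier X x0 -> f x0 != 0 ->
  one_codimensional X kernel_in.
Proof.
move=> Xx0 fx0; split; first by move=> w [].
exists x0; first by split => // -[_ /= fx00]; move/eqP: fx0.
move=> x Xx; exists ((f x : K) / (f x0 : K)); split.
  by apply: carrierB => //; exact: carrierZ.
by rewrite /= linearB linearZ/= -[_ *: _]/(_ * _) divfK ?subrr.
Qed.

End kernel.

(** If [f] vanishes on [X], its kernel in [X] has codimension 0; the kernel of a norming functional
    of [x0] is taken instead, and [f] vanishes there anyway. *)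
Lemma one_codimensional_in_kernel X (f : {linear W -> K^o}) x0 : continuous f ->
  carrier X x0 -> x0 != 0 ->
  exists2 Y, one_codimensional X Y & forall w, carrier Y w -> f w = 0.
Proof.
move=> fc Xx0 x00.
have [[x1 Xx1 fx1]|fX] := pselect (exists2 x1, carrier X x1 & f x1 != 0).
  exists (kernel_in X f fc); first exact: kernel_in_one_codimensional fx1.
  by move=> w [].
have [g0 [g0f _ g0x0]] := norming_functional _ _ _ x0.
have [g gc gE] := functional_linear _ g0f.
exists (kernel_in X g gc).
  apply: kernel_in_one_codimensional Xx0 _.
  apply/eqP => gx0; have : re ((g : W -> K) x0) = rnorm x0 by rewrite gE.
  by rewrite gx0 re0 => /esym/eqP; rewrite rnorm_eq0 (negbTE x00).
by move=> w [Xw _]; apply: contrapT => /eqP fw; apply: fX; exists w.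
Qed.

End codimension_one.

(** * Rich subspaces of [L1]: approximation of half the ball in measure *)

Section L1_rich.
Context {R : realType} {s : scalars} {d : measure_display}.
Context {T : measurableType d} {P : probability T R}.
Local Notation K := (scalar_field R s).
Local Notation L1P := (L1 s P).
Implicit Types (X Y : closed_subspace L1P) (f g h x y u v w : L1P) (e : R).

Lemma ofR_half : ofR 2^-1 = 2^-1 :> K. Proof. by rewrite ofRV ofR_nat. Qed.

Lemma rich_half_sphere X Y f e : rich X -> one_codimensional X Y ->
  rnorm f = 1 -> 0 < e ->
  exists g, [/\ carrier Y g, rnorm g <= 1 & small_in_measure e (2^-1 *: f - g)].
Proof.
move=> Xr XY f1 e0; pose e1 := e / 2.
have e10 : 0 < e1 by rewrite divr_gt0.
have [c c0 cP] := @small_of_rnorm_add_sub_one _ s _ _ P e1 e10.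
(* In the decomposition of the error below, the terms other than [2^-1 *: v] each have norm at most
   [D / 2]; their sum stays under the [e1 ^+ 2] that [markov_small] asks for. *)
pose D := Num.min c (e1 ^+ 2 / 2).
have e120 : 0 < e1 ^+ 2 by rewrite exprn_gt0.
have D0 : 0 < D by rewrite /D lt_min c0 divr_gt0.
have Dc : D <= c by rewrite /D ge_min lexx.
have De : D <= e1 ^+ 2 / 2 by rewrite /D ge_min lexx orbT.
have one1 : rnorm (L1_one : L1P) = 1 by exact: rnorm_L1_one.
have oneN : rnorm (- L1_one : L1P) = 1 by rewrite rnormN.
have [v [z [v1 vp vm Yz fz]]] :=
  rich_two_points_one_codimensional X Y _ _ f D Xr XY one1 oneN f1 D0.
have sv : small_in_measure e1 v by apply: cP => //; lra.
have z2 : rnorm z <= 2 + D.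
  have -> : z = (f - v) - (f - v - z) by rewrite subKr.
  by have := rnormB (f - v) (f - v - z); have := rnormB f v; lra.
have D2 : 0 < 2 + D by lra.
have D2V : 0 <= (2 + D)^-1 <= 2^-1.
  by rewrite invr_ge0 ltW//= lef_pV2 ?posrE//; lra.
have [D2V0 D2V1] := andP D2V.
exists (ofR (2 + D)^-1 *: z); split.
- exact: carrierZ.
- by rewrite rnormZr ger0_norm// ler_pdivrMl// mulr1.
have -> : 2^-1 *: f - ofR (2 + D)^-1 *: z = 2^-1 *: v +
    (2^-1 *: (f - v - z) + ofR (2^-1 - (2 + D)^-1) *: z).
  rewrite ofRB ofR_half scalerBl !addrA; congr (_ - _).
  rewrite -!scalerDr; congr (_ *: _).
  by rewrite -addrA subrK addrC subrK.
rewrite [e]splitr; apply: small_in_measureD.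
  rewrite -[e / 2]mul1r; apply: small_in_measureZ => //.
  by rewrite -ofR_half rnorm_ofR ger0_norm; lra.
apply: markov_small => //; apply: le_lt_trans (rnormD _ _) _.
rewrite -ofR_half !rnormZr !ger0_norm ?subr_ge0//.
have : (2^-1 - (2 + D)^-1) * rnorm z <= (2^-1 - (2 + D)^-1) * (2 + D).
  by rewrite ler_wpM2l// subr_ge0.
rewrite [leRHS]mulrBl mulVf ?gt_eqF//.
have : e1 ^+ 2 = (e / 2) ^+ 2 by [].
lra.
Qed.

Lemma rich_half_ball X Y f : rich X -> one_codimensional X Y ->
  rnorm f <= 1 -> measure_closure Y (2^-1 *: f).
Proof.
move=> Xr XY f1; apply/measure_closureP => e e0.
suff [g [Yg g1 sg]] : exists g, [/\ carrier Y g, rnorm g <= 1 &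
    small_in_measure e (2^-1 *: f - g)].
  by exists g; split => //; [rewrite norm_le1|exact/small_in_measureB].
have [->|f0] := eqVneq f 0.
  exists 0; split; [exact: carrier0|by rewrite rnorm0|].
  by apply: markov_small => //; rewrite scaler0 subr0 rnorm0 exprn_gt0.
have fp : 0 < rnorm f by rewrite rnorm_gt0.
have f'1 : rnorm (ofR (rnorm f)^-1 *: f) = 1.
  by rewrite rnormZr gtr0_norm ?invr_gt0// mulVf// gt_eqF.
have [g [Yg g1 sg]] := rich_half_sphere X Y _ e Xr XY f'1 e0.
exists (ofR (rnorm f) *: g); split.
- exact: carrierZ.
- by rewrite rnormZr ger0_norm ?rnorm_ge0// mulr_ile1 ?rnorm_ge0.
have -> : 2^-1 *: f - ofR (rnorm f) *: g =
    ofR (rnorm f) *: (2^-1 *: (ofR (rnorm f)^-1 *: f) - g).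
  by rewrite scalerBr !scalerA mulrAC -ofRM divff ?gt_eqF// ofR1 mul1r.
rewrite -[e]mul1r; apply: small_in_measureZ => //.
by rewrite rnorm_ofR ger0_norm ?rnorm_ge0.
Qed.

(** * From approximation in measure back to richness *)

Section converse.
Context Y (Y_half : [set 2^-1 *: f | f in unit_ball L1P] `<=` measure_closure Y).

Let approx f e : rnorm f <= 1 -> 0 < e ->
  exists g, [/\ carrier Y g, rnorm g <= 2 & small_in_measure e (f - g)].
Proof.
move=> f1 e0; have Bf : unit_ball L1P f by rewrite /unit_ball/= norm_le1.
have e20 : 0 < e / 2 by rewrite divr_gt0.
have := Y_half _ (ex_intro2 _ _ f Bf erefl).
move=> /measure_closureP/(_ _ e20)[g [Yg g1 /small_in_measureB sg]].
have n2 : rnorm (2 : K) = 2 by rewrite -ofR_nat rnorm_ofR ger0_norm.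
exists ((2 : K) *: g); split.
- exact: carrierZ.
- by rewrite rnormZ n2 ler_piMr//; rewrite norm_le1 in g1.
have -> : f - (2 : K) *: g = (2 : K) *: (2^-1 *: f - g).
  by rewrite scalerBr scalerA mulfV ?pnatr_eq0// scale1r.
rewrite -[e](divfK (_ : 2 != 0 :> R))// mulrC.
by apply: small_in_measureZ; rewrite ?n2//; lra.
Qed.

(* Two approximations in measure of a function outside Y, the second one much
   finer than the first one, differ by such an element of Y. *)
Let spikes f0 : ~ carrier Y f0 -> exists2 c : R, 0 < c & forall e, 0 < e ->
  exists w, [/\ carrier Y w, c <= rnorm w & small_in_measure e w].
Proof.
move=> Yf0; have f00 : 0 < rnorm f0.
  by rewrite rnorm_gt0; apply/eqP => f0E; apply: Yf0; rewrite f0E; exact: carrier0.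
pose f := ofR (rnorm f0)^-1 *: f0.
have f1 : rnorm f = 1.
  by rewrite rnormZr gtr0_norm ?invr_gt0// mulVf// gt_eqF.
have Yf : ~ carrier Y f.
  move=> Yf; apply: Yf0; have -> : f0 = ofR (rnorm f0) *: f.
    by rewrite scaleofRA divff ?gt_eqF// ofR1 scale1r.
  exact: carrierZ.
pose c := rnorm (quotient_map Y f).
have c0 : 0 < c.
  rewrite /c rnorm_gt0; apply/eqP; rewrite -(raddf0 (quotient_map Y)).
  by move/lprojP; rewrite subr0.
have fY g : carrier Y g -> c <= rnorm (f - g).
  move=> Yg; rewrite /c (_ : quotient_map Y f = quotient_map Y (f - g)).
    by rewrite rnorm_quotient quotient_rnorm_le.
  by apply/lprojP; rewrite opprB addrC subrK.
exists c => // e e0; have e20 : 0 < e / 2 by rewrite divr_gt0.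
have f_le1 : rnorm f <= 1 by rewrite f1.
have [g1 [Yg1 _ sg1]] := approx _ _ f_le1 e20.
(* Here [c] is the distance from [f] to [Y], so [f - g1] and [f - g2] both have norm at least [c];
   losing [c] in the triangle inequality still leaves [c]. *)
have [b b0 bP] := almost_disjoint (- (f - g1)) c c0.
pose a := Num.min b (e / 2).
have a0 : 0 < a by rewrite /a lt_min b0.
have [g2 [Yg2 _ sg2]] := approx _ _ f_le1 a0.
have wE : g1 - g2 = - (f - g1) + (f - g2) by rewrite opprB subrKA.
exists (g1 - g2); split; first exact: carrierB.
- have ab : a <= b by rewrite /a ge_min lexx.
  have := bP _ (le_small_in_measure _ _ _ ab sg2); rewrite -wE rnormN.
  by have := fY _ Yg1; have := fY _ Yg2; lra.
- have ae2 : a <= e / 2 by rewrite /a ge_min lexx orbT.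
  rewrite wE; have ae : e / 2 + a <= e by lra.
  apply: le_small_in_measure ae _.
  by apply: small_in_measureD => //; exact: small_in_measureN.
Qed.

(** Since [u = y - g] is almost disjoint from [y] and [g] has norm at most 2, [u] has norm at most
    [1 + a], and the factor [1 - a] brings it into the ball. A multiple of a spike in [Y] then
    raises the norm to 1, and smallness in measure makes the result almost disjoint from [x]. *)
Lemma peak_in_coset f0 x y (a e : R) : ~ carrier Y f0 -> rnorm x = 1 ->
  rnorm y = 1 -> 0 < a -> a <= 1 -> 0 < e ->
  exists v, [/\ rnorm v = 1, 2 - e < rnorm (x + v) &
    carrier Y (ofR (1 - a) *: y - v)].
Proof.
move=> Yf0 x1 y1 a0 a1 e0; have [c c0 wP] := spikes f0 Yf0.
have [b b0 bP] := almost_disjoint (- y) a a0.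
have e20 : 0 < e / 2 by rewrite divr_gt0.
have [k k0 kP] := almost_disjoint x (e / 2) e20.
have k20 : 0 < k / 2 by rewrite divr_gt0.
pose e1 := Num.min b (k / 2).
have e10 : 0 < e1 by rewrite /e1 lt_min b0.
have e1b : e1 <= b by rewrite /e1 ge_min lexx.
have e1k : e1 <= k / 2 by rewrite /e1 ge_min lexx orbT.
have y_le1 : rnorm y <= 1 by rewrite y1.
have [g [Yg g2 sg]] := approx y e1 y_le1 e10.
set u := y - g in sg.
have u1 : rnorm u <= 1 + a.
  have := bP _ (le_small_in_measure _ _ _ e1b sg).
  by rewrite /u addKr !rnormN y1; lra.
pose u' := ofR (1 - a) *: u.
have u'1 : rnorm u' <= 1.
  rewrite rnormZr ger0_norm ?subr_ge0//.
  have : (1 - a) * rnorm u <= (1 - a) * (1 + a) by rewrite ler_wpM2l// subr_ge0.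
  have : 0 <= a ^+ 2 by exact: sqr_ge0.
  lra.
(* The coefficient [t] of the spike is at most [2 / c]: there the spike has norm at least 2 against
   at most 1 for [u']. [M] bounds [t] and is at least 1, as [small_in_measureZ] requires. *)
pose M := 1 + 2 / c.
have c20 : 0 < 2 / c by rewrite divr_gt0.
have M0 : 0 < M by rewrite /M; lra.
have [w [Yw cw sw]] := wP (k / 2 / M) (divr_gt0 k20 M0).
have [t] : exists2 t, t \in `[0, 2 / c] & rnorm (u' + ofR t *: w) = 1.
  apply: (@IVT R (fun t => rnorm (u' + ofR t *: w))).
  - exact: ltW.
  - exact/continuous_subspaceT/rnorm_line_continuous.
  rewrite ofR0 scale0r addr0 ge_min u'1/= le_max; apply/orP; right.
  rewrite addrC (le_trans _ (rnormDr _ _))// rnormZr gtr0_norm//.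
  have : 2 / c * c <= 2 / c * rnorm w by rewrite ler_wpM2l// ltW.
  by rewrite divfK ?gt_eqF//; lra.
rewrite in_itv/= => /andP[t0 tc] vt.
exists (u' + ofR t *: w); split=> //.
- have sv : small_in_measure k (u' + ofR t *: w).
    rewrite [k]splitr; apply: small_in_measureD.
      rewrite -[k / 2]mul1r; apply: small_in_measureZ => //.
        by rewrite rnorm_ofR ger0_norm ?subr_ge0//; lra.
      exact: le_small_in_measure e1k sg.
    rewrite (_ : k / 2 = M * (k / 2 / M)); last first.
      by rewrite mulrCA divff ?mulr1 ?gt_eqF.
    apply: small_in_measureZ sw.
    + exact: divr_gt0.
    + by rewrite /M; lra.
    + by rewrite rnorm_ofR ger0_norm// /M; lra.
  by have := kP _ sv; rewrite x1 vt; lra.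
- rewrite opprD addrA -scalerBr subKr; apply: carrierB; exact: carrierZ.
Qed.

End converse.

End L1_rich.

Theorem theorem2p4 (R : realType) (s : scalars) (d : measure_display)
    (T : measurableType d) (P : probability T R) (X : closed_subspace (L1 s P))
    (X_neq0 : exists2 f : L1 s P, carrier X f & f != 0) :
  rich X <->
  forall Y : closed_subspace (L1 s P), one_codimensional X Y ->
    [set 2^-1 *: f | f in unit_ball (L1 s P)] `<=` measure_closure Y.
Proof.
split=> [Xr Y XY _ [f f1 <-]|XH].
  by apply: rich_half_ball Xr XY _; rewrite -norm_le1.
split; first exact: quotient_map_continuous.
move=> x y e S /norm_eq1 x1 /norm_eq1 y1 /gt0_ofR[eE e0].
move=> [_ [f [alpha [fc ->]]]] [_ fy].
move: (rnorm e) e0 eE => e' e0 ->.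
(* A nonzero element ensures that some one-codimensional [Y] exists; for the zero subspace the
   right-hand side would hold vacuously. *)
have [x0 Xx0 x00] := X_neq0.
have [Y XY fY] := one_codimensional_in_kernel X f x0 fc Xx0 x00.
have [YX [f0 [_ Yf0] _]] := XY.
pose r := re (f y : scalar_field R s).
(* The vector to be found satisfies [f v = (1 - a) f y], so it stays in the slice as soon as [a * r]
   is less than the margin [r - alpha]; the 1 in the denominator covers [r = 0]. *)
pose b := (r - alpha) / (1 + `|r|).
have r1 : 0 < 1 + `|r| by have := normr_ge0 r; lra.
have b0 : 0 < b by rewrite divr_gt0// subr_gt0.
pose a := Num.min 2^-1 (Num.min (e' / 2) (b / 2)).
have a0 : 0 < a.
  by rewrite /a !lt_min; apply/and3P; split; lra.
have a2 : a <= 2^-1 by rewrite /a ge_min lexx.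
have ae : a <= e' / 2 by rewrite /a !ge_min lexx !orbT.
have ab : a <= b / 2 by rewrite /a !ge_min lexx !orbT.
have a1 : a <= 1 by lra.
have [v [v1 xv Yv]] := peak_in_coset Y (XH Y XY) f0 x y a e' Yf0 x1 y1 a0 a1 e0.
exists v; split.
- split; first by rewrite norm_le1 v1.
  have -> : f v = ofR (1 - a) *: f y.
    by apply/esym/eqP; rewrite -subr_eq0 -linearZ -linearB; apply/eqP/fY.
  rewrite -[_ *: _]/(_ * _) reMofR -/r.
  have : b * (1 + `|r|) = r - alpha by rewrite divfK ?gt_eqF.
  have : a * (1 + `|r|) < b * (1 + `|r|) by rewrite ltr_pM2r//; lra.
  have : a * r <= a * `|r| by rewrite ler_wpM2l ?ler_norm// ltW.
  lra.
- by rewrite -ofR_nat -ofRB norm_gtE.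
- rewrite norm_ltE.
  (* Modulo [Y], hence modulo [X], the vector [v] is [(1 - a) y], so [y - v] has the same class as
     [a y]. *)
  rewrite [X in rnorm X](_ : _ = quotient_map X (ofR a *: y)); last first.
    apply/lprojP; rewrite addrAC -{1}[y]scale1r -scalerBl -ofR1 -ofRB.
    exact: YX.
  rewrite rnorm_quotient.
  apply: le_lt_trans (quotient_rnorm_le X (ofR a *: y)) _.
  by rewrite rnormZr y1 mulr1 gtr0_norm//; lra.
Qed.
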